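(* For every $1<\alpha<2$, the norm of the Hilbert matrix operator $\mathcal{H}$ acting from $\mathcal{B}^\alpha$ into $\mathcal{B}^\alpha_{\log}$ satisfies $$\|\mathcal{H}\|_{\mathcal{B}^\alpha\to\mathcal{B}^\alpha_{\log}}\le\frac{\pi}{\sin((\alpha-1)\pi)}+\frac{1}{2-\alpha}.$$
   Context: Let $\mathbb{D}$ be the open unit disk of $\mathbb{C}$ and $H(\mathbb{D})$ the set of all analytic functions in $\mathbb{D}$. For $f(z)=\sum_{k=0}^\infty a_kz^k\in H(\mathbb{D})$, the Hilbert matrix operator is defined by $$\mathcal{H}f(z)=\sum_{n=0}^\infty\left(\sum_{k=0}^\infty\frac{a_k}{n+k+1}\right)z^n,$$ whenever the right-hand side makes sense (the inner series converging as ordinary limits of partial sums) and defines an analytic function in $\mathbb{D}$. For $0<\alpha<\infty$, the $\alpha$-Bloch space $\mathcal{B}^\alpha$ consists of all $f\in H(\mathbb{D})$ with $$\|f\|_{\mathcal{B}^\alpha}=|f(0)|+\sup_{z\in\mathbb{D}}(1-|z|^2)^\alpha|f'(z)|<\infty,$$ and the logarithmically weighted $\alpha$-Bloch space $\mathcal{B}^\alpha_{\log}$ consists of all $f\in H(\mathbb{D})$ with $$\|f\|_{\mathcal{B}^\alpha_{\log}}=|f(0)|+\sup_{z\in\mathbb{D}}\left(\log\frac{e}{(1-|z|)^2}\right)^{-1}(1-|z|^2)^\alpha|f'(z)|<\infty.$$ The operator norm is $\|\mathcal{H}\|_{\mathcal{B}^\alpha\to\mathcal{B}^\alpha_{\log}}=\sup\{\|\mathcal{H}f\|_{\mathcal{B}^\alpha_{\log}}/\|f\|_{\mathcal{B}^\alpha}: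 0\ne f\in\mathcal{B}^\alpha\}$. *)

(* Defs.v *)
From Stdlib Require Import Reals.
From Coquelicot Require Import Coquelicot.
Open Scope R_scope.

Definition disk (z : C) : Prop := Cmod z < 1.

Definition taylor_on_disk (a : nat -> C) (f : C -> C) : Prop :=
  forall z : C, disk z ->
    @is_pseries C_AbsRing C_NormedModule a z (f z).

(* H(D): a function on the disk is analytic when it is the sum there of a power
   series.  Elements of H(D) are represented by total functions on C; nothing
   below depends on their values outside the disk. *)
Definition analytic (f : C -> C) : Prop :=
  exists a : nat -> C, taylor_on_disk a f.

(* is_hilbert f g: the Hilbert matrix operator is defined at f and maps it to g.
   The inner series converge as limits of partial sums, not necessarily
   absolutely. *)
Definition is_hilbert (f g : C -> C) : Prop :=
  exists a b : nat -> C,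
    taylor_on_disk a f /\
    (forall n : nat,
       @is_series C_AbsRing C_NormedModule
         (fun k : nat => Cdiv (a k) (RtoC (INR (n + k + 1)))) (b n)) /\
    taylor_on_disk b g.

(* C_derive takes the limit of difference quotients along the real direction,
   which for analytic f is the complex derivative. *)
Definition weighted_bloch_norm (w : R -> R) (f : C -> C) : Rbar :=
  Rbar_plus (Cmod (f (RtoC 0)))
    (Lub_Rbar (fun x : R =>
       exists z : C, disk z /\ x = w (Cmod z) * Cmod (C_derive f z))).

Definition bloch_norm (alpha : R) : (C -> C) -> Rbar :=
  weighted_bloch_norm (fun r : R => Rpower (1 - r ^ 2) alpha).

Definition bloch_log_norm (alpha : R) : (C -> C) -> Rbar :=
  weighted_bloch_norm
    (fun r : R => / ln (exp 1 / (1 - r) ^ 2) * Rpower (1 - r ^ 2) alpha).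

Definition in_bloch (alpha : R) (f : C -> C) : Prop :=
  analytic f /\ Rbar_lt (bloch_norm alpha f) p_infty.

Definition in_bloch_log (alpha : R) (f : C -> C) : Prop :=
  analytic f /\ Rbar_lt (bloch_log_norm alpha f) p_infty.

Definition nonzero_on_disk (f : C -> C) : Prop :=
  exists z : C, disk z /\ f z <> RtoC 0.

Definition hilbert_acts (alpha : R) : Prop :=
  forall f : C -> C, in_bloch alpha f ->
    exists g : C -> C, is_hilbert f g /\ in_bloch_log alpha g.

Definition hilbert_norm (alpha : R) : Rbar :=
  Rbar_lub (fun x : Rbar =>
    exists f g : C -> C,
      in_bloch alpha f /\ nonzero_on_disk f /\ is_hilbert f g /\
      x = Rbar_div (bloch_log_norm alpha g) (bloch_norm alpha f)).

(* Main.v *)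
Require Import Defs.
From Stdlib Require Import Reals.
From Coquelicot Require Import Coquelicot.
From Stdlib Require Import Lra Lia ClassicalEpsilon.
Open Scope R_scope.

(** For [1 < alpha < 2] an [f] in the alpha-Bloch space is integrable on [[0, 1]],
    since [|f z| = O((1 - |z|) ^ (1 - alpha))], and the Hilbert matrix turns out
    to be integration: [b_n] is the integral of [t ^ n * f t], so that [g' z] is
    the integral of [t * f t / (1 - t * z) ^ 2].  Write [A] for the supremum of
    [(1 - |z| ^ 2) ^ alpha * |f' z|] and [r] for [|z|].  One integration by parts
    replaces [f] by [f (0)] and [f'], and Fubini then leaves, besides a
    contribution of [f (0)] of size at most [|f (0)| / (1 - r)], the real integral
    of
      [A * (1 - s ^ 2) ^ (- alpha) * (1 - s) / ((1 - r) * (1 - s * r))]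
    over [0 < s < 1].  For [s <= r] the integrand is at most
    [A * (1 - r ^ 2) ^ (- alpha)] times the derivative of
    [ln ((1 + s) / (1 - s * r))] ([weight_le_inner]); for [s >= r] it is at most a
    constant times [(1 - s) ^ (1 - alpha)] ([weight_le_outer]).  Altogether
      [(1 - r ^ 2) ^ alpha * |g' z| <= 2 * |f (0)| + A * (l + 1 / (2 - alpha))],
    where [l = - ln (1 - r)].  The logarithmic weight is [1 / (1 + 2 * l)] and
    [1 / (2 - alpha) >= 1], hence the weighted derivative is at most
    [2 * |f (0)| + A / (2 - alpha)] ([hilbert_image_weighted_le]).  Together with
    [|g (0)| <= |f (0)| + A / (2 - alpha)] the norm of [g] is at most
    [3 * |f (0)| + 2 * A / (2 - alpha)], and both constants are dominated by
    [PI / sin ((alpha - 1) * PI) + 1 / (2 - alpha)], because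
    [sin ((alpha - 1) * PI) = sin ((2 - alpha) * PI)] is at most [1] and at most
    [(2 - alpha) * PI] ([PI_sin_constant_le]).

    The integrals never appear as such: they are increments of explicit
    primitives, compared by a mean value inequality ([Cmean_value_le]).  The
    primitive attached to [b_n] is built from power series and tends to [b_n] at
    [1] by Abel's theorem ([hilbert_regularization]).

    The remaining point is that the series of [a_k / (n + k + 1)] converges at
    all, since it may fail to converge absolutely.  Summation by parts reduces
    this to [a_0 + ... + a_N = O(N ^ gamma)] with some [gamma < 1]
    ([hilbert_coef_converges]).  That follows from the growth of [f] on the circle
    of radius [1 - 1 / (2 * (N + 1))] and from Landau's inequality, by which a
    partial sum of Taylor coefficients exceeds the supremum of the function by a
    logarithmic factor only ([landau_polynomial], [taylor_partial_sums_le]). *)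

(** * Finite sums and series of complex numbers *)

(** The recursion uses [Cplus] itself rather than the abstract operation of
    [sum_n], so that [ring] can rearrange partial sums. *)
Fixpoint csum (u : nat -> C) (n : nat) : C :=
  match n with
  | O => u O
  | S i => (csum u i + u (S i))%C
  end.

Notation cseries := (@is_series C_AbsRing C_NormedModule).

Lemma csum_sum_n u n :
  @sum_n (NormedModule.AbelianMonoid C_AbsRing C_NormedModule) u n = csum u n.
Proof.
  induction n as [|n IH].
  - now rewrite sum_O.
  - rewrite sum_Sn, IH. reflexivity.
Qed.

Lemma csum_ext u v n :
  (forall k, (k <= n)%nat -> u k = v k) -> csum u n = csum v n.
Proof.
  induction n as [|n IH]; intros H; simpl.
  - now apply H.
  - rewrite IH by (intros; apply H; lia). now rewrite (H (S n)) by lia.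
Qed.

Lemma csum_scal c u n : csum (fun k => c * u k)%C n = (c * csum u n)%C.
Proof.
  induction n as [|n IH]; simpl; [reflexivity|].
  rewrite IH. ring.
Qed.

Lemma csum_plus u v n :
  csum (fun k => u k + v k)%C n = (csum u n + csum v n)%C.
Proof.
  induction n as [|n IH]; simpl; [reflexivity|].
  rewrite IH. ring.
Qed.

Lemma csum_minus u v n :
  csum (fun k => u k - v k)%C n = (csum u n - csum v n)%C.
Proof.
  induction n as [|n IH]; simpl; [reflexivity|].
  rewrite IH. ring.
Qed.

Lemma csum_switch (u : nat -> nat -> C) m n :
  csum (fun i => csum (u i) n) m = csum (fun j => csum (fun i => u i j) m) n.
Proof.
  induction m as [|m IH]; simpl; [reflexivity|].
  now rewrite IH, <- csum_plus.
Qed.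

Lemma csum_RtoC (u : nat -> R) n :
  csum (fun k => RtoC (u k)) n = RtoC (sum_f_R0 u n).
Proof.
  induction n as [|n IH]; simpl; [reflexivity|].
  now rewrite IH, RtoC_plus.
Qed.

Lemma csum_truncate (u : nat -> C) d n :
  (d <= n)%nat ->
  csum (fun i => if Nat.leb i d then u i else RtoC 0) n = csum u d.
Proof.
  intros H. induction n as [|n IH].
  - replace d with O by lia. reflexivity.
  - destruct (Nat.eq_dec d (S n)) as [->|Hd]; cbn [csum].
    + rewrite (Nat.leb_refl (S n)). f_equal.
      apply csum_ext. intros k Hk.
      now rewrite (proj2 (Nat.leb_le k (S n))) by lia.
    + rewrite IH by lia. replace (S n <=? d)%nat with false.
      * ring.
      * symmetry. apply Nat.leb_gt. lia.
Qed.

Lemma csum_0 (u : nat -> C) n :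
  (forall k, (k <= n)%nat -> u k = RtoC 0) -> csum u n = RtoC 0.
Proof.
  intros H. rewrite (csum_ext u (fun _ => RtoC 0 * RtoC 0)%C).
  - rewrite csum_scal. ring.
  - intros k Hk. rewrite H by exact Hk. ring.
Qed.

Lemma csum_delta (u : nat -> C) d n :
  (d <= n)%nat ->
  csum (fun i => if Nat.eqb i d then u i else RtoC 0) n = u d.
Proof.
  intros H. induction n as [|n IH].
  - replace d with O by lia. reflexivity.
  - cbn [csum]. destruct (Nat.eqb_spec (S n) d) as [<-|Hd].
    + rewrite csum_0; [ring|]. intros k Hk.
      destruct (Nat.eqb_spec k (S n)); [lia|reflexivity].
    + rewrite IH by lia. ring.
Qed.

Lemma Cmod_csum u n : Cmod (csum u n) <= sum_f_R0 (fun k => Cmod (u k)) n.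
Proof.
  induction n as [|n IH]; simpl; [lra|].
  eapply Rle_trans; [apply Cmod_triangle|lra].
Qed.

Lemma Cmod_minus_sym x y : Cmod (x - y) = Cmod (y - x).
Proof. rewrite <- Cmod_opp. f_equal. ring. Qed.

Lemma Cmod_triangle_minus x y z :
  Cmod (x - z) <= Cmod (x - y) + Cmod (y - z).
Proof. replace (x - z)%C with ((x - y) + (y - z))%C by ring. apply Cmod_triangle. Qed.

Lemma Cmod_le_add x y : Cmod x <= Cmod y + Cmod (x - y).
Proof. replace x with (y + (x - y))%C at 1 by ring. apply Cmod_triangle. Qed.

(** ** Convergence in terms of partial sums *)

Lemma filterlim_C_iff {T} (F : (T -> Prop) -> Prop) {FF : Filter F}
    (f : T -> C) (l : C) :
  filterlim f F (@locally C_NormedModule l) <->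
  forall eps : R, 0 < eps -> F (fun x => Cmod (f x - l) < eps).
Proof.
  rewrite (@filterlim_locally_ball_norm C_AbsRing T C_NormedModule F FF f l).
  split.
  - intros H eps He. exact (H (mkposreal eps He)).
  - intros H eps. exact (H eps (cond_pos eps)).
Qed.

Lemma cseries_iff (u : nat -> C) (l : C) :
  cseries u l <->
  forall eps : R, 0 < eps ->
    exists N, forall n, (N <= n)%nat -> Cmod (csum u n - l) < eps.
Proof.
  unfold is_series. rewrite (@filterlim_C_iff nat eventually _).
  split; intros H eps He; destruct (H eps He) as [N HN]; exists N; intros n Hn;
    specialize (HN n Hn); now rewrite csum_sum_n in *.
Qed.

Lemma cseries_ext (u v : nat -> C) (l : C) : (forall k, u k = v k) -> cseries u l -> cseries v l.
Proof. intros H. apply is_series_ext. exact H. Qed.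

Lemma cseries_scal (c : C) (u : nat -> C) (l : C) :
  cseries u l -> cseries (fun k => c * u k)%C (c * l)%C.
Proof. intros H. exact (is_series_scal c u l H). Qed.

Lemma cseries_minus (u v : nat -> C) (l m : C) :
  cseries u l -> cseries v m -> cseries (fun k => u k - v k)%C (l - m)%C.
Proof. intros H1 H2. exact (is_series_minus u v l m H1 H2). Qed.

Lemma cseries_unique (u : nat -> C) (l m : C) : cseries u l -> cseries u m -> l = m.
Proof.
  intros H1 H2. exact (@filterlim_locally_unique nat C_AbsRing C_NormedModule eventually _ _ l m H1 H2).
Qed.

Lemma cseries_shift (u : nat -> C) (l : C) :
  cseries u l -> cseries (fun k => u (S k)) (l - u O)%C.
Proof.
  intros H. apply is_series_incr_1.
  change (cseries u ((l - u O) + u O)%C).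
  now replace ((l - u O) + u O)%C with l by ring.
Qed.

Lemma ex_cseries_le (u : nat -> C) (v : nat -> R) :
  (forall k, Cmod (u k) <= v k) -> ex_series v -> exists l : C, cseries u l.
Proof.
  intros H Hv. exact (@ex_series_le C_AbsRing C_CompleteNormedModule u v H Hv).
Qed.

(** The truncation error is controlled by the majorant alone, hence uniformly over
    all series with that majorant; on a circle this is uniform convergence. *)
Lemma cseries_Cmod_tail (u : nat -> C) (v : nat -> R) (l : C) (L : R) :
  cseries u l -> (forall k, Cmod (u k) <= v k) -> is_series v L ->
  forall n, Cmod (l - csum u n) <= L - sum_f_R0 v n.
Proof.
  intros Hu Huv Hv n.
  apply le_epsilon. intros eps He.
  destruct (proj1 (cseries_iff u l) Hu eps He) as [N HN].
  set (m := (N + n)%nat).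
  assert (Hm : Cmod (csum u m - csum u n) <= sum_f_R0 v m - sum_f_R0 v n).
  { unfold m. generalize N as p. intros p. clear -Huv. induction p as [|p IH].
    - simpl. replace (csum u n - csum u n)%C with (RtoC 0) by ring.
      rewrite Cmod_0. lra.
    - simpl. replace (csum u (p + n) + u (S (p + n)) - csum u n)%C
        with ((csum u (p + n) - csum u n) + u (S (p + n)))%C by ring.
      eapply Rle_trans; [apply Cmod_triangle|].
      specialize (Huv (S (p + n))). lra. }
  assert (HL : sum_f_R0 v m <= L).
  { apply is_series_Reals in Hv.
    apply (sum_incr v m L Hv).
    intros k. eapply Rle_trans; [apply Cmod_ge_0|apply Huv]. }
  specialize (HN m ltac:(unfold m; lia)).
  rewrite Cmod_minus_sym in HN.
  pose proof (Cmod_triangle_minus l (csum u m) (csum u n)). lra.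
Qed.

Lemma cseries_Cmod_le (u : nat -> C) (v : nat -> R) (l : C) (L : R) :
  cseries u l -> (forall k, Cmod (u k) <= v k) -> is_series v L -> Cmod l <= L.
Proof.
  intros Hu Huv Hv.
  pose proof (cseries_Cmod_tail u v l L Hu Huv Hv 0) as H. simpl in H.
  pose proof (Cmod_le_add l (u O)). pose proof (Huv O). lra.
Qed.

Lemma cseries_Cmod_partial_le (u : nat -> C) (l : C) (B : R) :
  cseries u l -> (forall n, Cmod (csum u n) <= B) -> Cmod l <= B.
Proof.
  intros Hu HB. apply le_epsilon. intros eps He.
  destruct (proj1 (cseries_iff u l) Hu eps He) as [N HN].
  specialize (HN N (le_n N)). specialize (HB N).
  rewrite Cmod_minus_sym in HN.
  pose proof (Cmod_le_add l (csum u N)). lra.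
Qed.

Lemma cseries_terms_bounded (u : nat -> C) (l : C) :
  cseries u l -> exists K, forall k, Cmod (u k) <= K.
Proof.
  intros H.
  destruct (proj1 (cseries_iff u l) H 1 Rlt_0_1) as [N HN].
  assert (Hmax : exists K, forall k, (k <= N)%nat -> Cmod (u k) <= K).
  { clear. induction N as [|N [K HK]].
    - exists (Cmod (u O)). intros k Hk. replace k with O by lia. lra.
    - exists (Rmax K (Cmod (u (S N)))). intros k Hk.
      destruct (Nat.eq_dec k (S N)) as [->|Hne]; [apply Rmax_r|].
      eapply Rle_trans; [apply HK; lia|apply Rmax_l]. }
  destruct Hmax as [K HK].
  exists (Rmax K 2). intros k.
  destruct (Nat.le_gt_cases k N) as [Hk|Hk].
  - eapply Rle_trans; [now apply HK|apply Rmax_l].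
  - eapply Rle_trans; [|apply Rmax_r].
    destruct k as [|k]; [lia|].
    pose proof (HN (S k) ltac:(lia)) as H1. pose proof (HN k ltac:(lia)) as H2.
    simpl in H1.
    replace (u (S k)) with ((csum u k + u (S k) - l) - (csum u k - l))%C by ring.
    pose proof (Cmod_triangle (csum u k + u (S k) - l) (- (csum u k - l))) as H3.
    rewrite Cmod_opp in H3. unfold Cminus at 1. lra.
Qed.

(** * Differentiation of power series on the disk *)

Lemma pow_n_Cpow (z : C) k : @pow_n C_Ring z k = (z ^ k)%C.
Proof.
  induction k as [|k IH]; [reflexivity|].
  simpl. rewrite IH. reflexivity.
Qed.

Lemma taylor_on_disk_iff a f :
  taylor_on_disk a f <->
  forall z, disk z -> cseries (fun k => a k * z ^ k)%C (f z).
Proof.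
  split; intros H z Hz; specialize (H z Hz); unfold is_pseries in *;
    (eapply cseries_ext; [|exact H]); intros k; cbv beta.
  - exact (eq_trans (Cmult_comm _ _) (f_equal (Cmult (a k)) (pow_n_Cpow z k))).
  - exact (eq_trans (f_equal (Cmult (a k)) (eq_sym (pow_n_Cpow z k))) (Cmult_comm _ _)).
Qed.

Definition deriv_coef (a : nat -> C) (k : nat) : C :=
  (RtoC (INR (S k)) * a (S k))%C.

Lemma taylor_coef_bound a f s :
  taylor_on_disk a f -> 0 < s < 1 ->
  exists K, 0 < K /\ forall k, Cmod (a k) * s ^ k <= K.
Proof.
  intros Hf Hs. rewrite taylor_on_disk_iff in Hf.
  specialize (Hf (RtoC s)).
  destruct (cseries_terms_bounded _ _ (Hf ltac:(unfold disk; rewrite Cmod_R, Rabs_pos_eq; lra)))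
    as [K HK].
  exists (Rmax K 1). split; [apply Rlt_le_trans with 1; [lra|apply Rmax_r]|].
  intros k. eapply Rle_trans; [|apply Rmax_l]. specialize (HK k).
  rewrite Cmod_mult, <- RtoC_pow, Cmod_R, Rabs_pos_eq in HK; [exact HK|].
  apply pow_le; lra.
Qed.

Ltac ring_C := cbv beta; match goal with |- ?x = ?y => change (@eq C x y) end; ring.
Ltac ring_R := cbv beta; match goal with |- ?x = ?y => change (@eq R x y) end; ring.

Lemma rseries_scal (c : R) (v : nat -> R) (L : R) :
  is_series v L -> is_series (fun k => c * v k) (c * L).
Proof. exact (is_series_scal_l c v L). Qed.

Lemma rseries_unshift (v : nat -> R) (L : R) :
  v O = 0 -> is_series (fun k => v (S k)) L -> is_series v L.
Proof.
  intros H0 H. apply is_series_decr_1.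
  change (is_series (fun k => v (S k)) (L + - v O)).
  now replace (L + - v O) with L by (rewrite H0; ring).
Qed.

Lemma ex_series_square_geom q :
  0 < q < 1 -> ex_series (fun k => INR (S k) ^ 2 * q ^ k).
Proof.
  intros Hq.
  assert (Hp : forall k, 0 < INR (S k) ^ 2 * q ^ k).
  { intros k. apply Rmult_lt_0_compat; apply pow_lt; [apply lt_0_INR; lia|lra]. }
  eapply ex_series_ext; [|apply (ex_series_DAlembert (fun k => INR (S k) ^ 2 * q ^ k) q)].
  - intros k. cbv beta. apply Rabs_pos_eq. now apply Rlt_le.
  - lra.
  - intros k. specialize (Hp k). lra.
  - apply is_lim_seq_ext with (fun k => (1 + / INR (S k)) * (1 + / INR (S k)) * q).
    + intros k. rewrite Rabs_pos_eq.
      * rewrite (S_INR (S k)). pose proof (lt_0_INR (S k) ltac:(lia)).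
        change (q ^ S k) with (q * q ^ k).
        pose proof (pow_lt q k (proj1 Hq)). field. lra.
      * apply Rlt_le, Rdiv_lt_0_compat; apply Hp.
    + assert (H1 : is_lim_seq (fun k => 1 + / INR (S k)) 1).
      { replace (Finite 1) with (Finite (1 + 0)) by (f_equal; lra).
        apply is_lim_seq_plus'; [apply is_lim_seq_const|].
        apply (is_lim_seq_incr_1 (fun k => / INR k)).
        replace (Finite 0) with (Rbar_inv p_infty) by reflexivity.
        apply is_lim_seq_inv; [apply is_lim_seq_INR|discriminate]. }
      replace (Finite q) with (Finite (1 * 1 * q)) by (f_equal; lra).
      apply is_lim_seq_mult'; [apply is_lim_seq_mult'; exact H1|apply is_lim_seq_const].
Qed.

(** The remainder [D k] on the left satisfies
    [D (S k) = (z + h) * D k + h ^ 2 * k * z ^ (k - 1)], which makes induction on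
    the exponent work; the factor [rho ^ 2] avoids the power [rho ^ (k - 2)]. *)
Lemma Cpow_remainder_le (z h : C) rho k :
  0 < rho -> Cmod z <= rho -> Cmod (z + h) <= rho ->
  rho ^ 2 * Cmod ((z + h) ^ k - z ^ k - h * (RtoC (INR k) * z ^ pred k)) <=
  Cmod h ^ 2 * (INR k ^ 2 * rho ^ k).
Proof.
  intros Hr Hz Hzh. induction k as [|k IH].
  - simpl. replace (1 - 1 - h * (0 * 1))%C with (RtoC 0) by ring.
    rewrite Cmod_0. lra.
  - assert (E : ((z + h) ^ S k - z ^ S k - h * (RtoC (INR (S k)) * z ^ pred (S k)))%C
      = ((z + h) * ((z + h) ^ k - z ^ k - h * (RtoC (INR k) * z ^ pred k))
        + h ^ 2 * (RtoC (INR k) * z ^ pred k))%C).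
    { rewrite S_INR, RtoC_plus. destruct k as [|k]; simpl; ring. }
    rewrite E. clear E.
    set (D := ((z + h) ^ k - z ^ k - h * (RtoC (INR k) * z ^ pred k))%C) in *.
    eapply Rle_trans.
    { apply Rmult_le_compat_l; [apply pow_le; lra|]. apply Cmod_triangle. }
    rewrite !Cmod_mult, !Cmod_pow, Cmod_R, (Rabs_pos_eq (INR k)) by apply pos_INR.
    pose proof (Cmod_ge_0 D). pose proof (Cmod_ge_0 h). pose proof (Cmod_ge_0 z).
    pose proof (pos_INR k) as Hk.
    assert (Hzk : rho * (INR k * Cmod z ^ pred k) <= INR k * rho ^ k).
    { destruct k as [|k]; [simpl; lra|]. simpl pred.
      assert (Cmod z ^ k <= rho ^ k) by (apply pow_incr; lra).
      change (rho ^ S k) with (rho * rho ^ k).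
      replace (rho * (INR (S k) * Cmod z ^ k))
        with (INR (S k) * rho * Cmod z ^ k) by ring.
      replace (INR (S k) * (rho * rho ^ k))
        with (INR (S k) * rho * rho ^ k) by ring.
      apply Rmult_le_compat_l; [|assumption].
      apply Rmult_le_pos; [apply pos_INR|lra]. }
    rewrite S_INR. change (rho ^ S k) with (rho * rho ^ k).
    assert (0 <= rho ^ k) by (apply pow_le; lra).
    assert (0 <= Cmod h ^ 2) by (apply pow_le; lra).
    assert (Hfirst : rho ^ 2 * (Cmod (z + h) * Cmod D)
      <= rho * (Cmod h ^ 2 * (INR k ^ 2 * rho ^ k))).
    { apply Rle_trans with (rho * (rho ^ 2 * Cmod D)).
      - assert (0 <= rho ^ 2 * Cmod D) by (apply Rmult_le_pos; [apply pow_le|]; lra).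
        replace (rho ^ 2 * (Cmod (z + h) * Cmod D))
          with (Cmod (z + h) * (rho ^ 2 * Cmod D)) by ring.
        now apply Rmult_le_compat_r.
      - apply Rmult_le_compat_l; lra. }
    assert (Hsecond : rho ^ 2 * (Cmod h ^ 2 * (INR k * Cmod z ^ pred k))
       <= rho * (Cmod h ^ 2 * (INR k * rho ^ k))).
    { replace (rho ^ 2 * (Cmod h ^ 2 * (INR k * Cmod z ^ pred k)))
        with ((rho * Cmod h ^ 2) * (rho * (INR k * Cmod z ^ pred k))) by ring.
      replace (rho * (Cmod h ^ 2 * (INR k * rho ^ k)))
        with ((rho * Cmod h ^ 2) * (INR k * rho ^ k)) by ring.
      apply Rmult_le_compat_l; [apply Rmult_le_pos; lra|exact Hzk]. }
    rewrite Rmult_plus_distr_l.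
    eapply Rle_trans; [apply Rplus_le_compat; [exact Hfirst|exact Hsecond]|].
    assert (0 <= rho * Cmod h ^ 2 * rho ^ k).
    { apply Rmult_le_pos; [apply Rmult_le_pos|]; lra. }
    nra.
Qed.

(** The coefficients are [O(s ^ (- k))] for every [s < 1], so the second-order
    remainders of the monomials sum up with the geometric majorant [k ^ 2 * q ^ k]. *)
Lemma taylor_quadratic a f z :
  taylor_on_disk a f -> disk z ->
  exists l K delta, 0 < delta /\ 0 <= K /\
    cseries (fun k => deriv_coef a k * z ^ k)%C l /\
    forall h, Cmod h < delta ->
      Cmod (f (z + h)%C - f z - h * l) <= K * Cmod h ^ 2.
Proof.
  intros Hf Hz. unfold disk in Hz. pose proof (Cmod_ge_0 z) as Hz0.
  (* The circle of radius [rho] leaves room for [z + h]; the larger radius [s]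
     turns the bound on the coefficients into geometric decay on it. *)
  set (rho := (1 + Cmod z) / 2). set (s := (1 + rho) / 2).
  assert (Hrho : 0 < rho < 1) by (unfold rho; lra).
  assert (Hs : rho < s < 1) by (unfold s; lra).
  destruct (taylor_coef_bound a f s Hf ltac:(lra)) as [K [HK0 HK]].
  set (q := rho / s).
  assert (Hq : 0 < q < 1).
  { unfold q. split; [apply Rdiv_lt_0_compat; lra|].
    apply Rmult_lt_reg_r with s; [lra|]. field_simplify; lra. }
  assert (Hark : forall k, Cmod (a k) * rho ^ k <= K * q ^ k).
  { intros k. replace rho with (s * q) by (unfold q; field; lra).
    rewrite Rpow_mult_distr, <- Rmult_assoc.
    apply Rmult_le_compat_r; [apply pow_le; lra|apply HK]. }
  destruct (ex_series_square_geom q Hq) as [L HL].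
  assert (HL' : is_series (fun k => INR k ^ 2 * q ^ k) (q * L)).
  { apply rseries_unshift; [simpl; ring|].
    eapply is_series_ext; [|exact (rseries_scal q _ _ HL)].
    intros k. change (q ^ S k) with (q * q ^ k). ring_R. }
  destruct (ex_cseries_le (fun k => RtoC (INR k) * (a k * z ^ pred k))%C
      (fun k => (K / rho) * (INR k ^ 2 * q ^ k))) as [l Hl].
  { intros k. rewrite !Cmod_mult, Cmod_R, Cmod_pow, Rabs_pos_eq by apply pos_INR.
    destruct k as [|k]; [simpl; lra|].
    apply Rmult_le_reg_l with rho; [lra|].
    replace (rho * (K / rho * (INR (S k) ^ 2 * q ^ S k)))
      with (INR (S k) ^ 2 * (K * q ^ S k)) by (field; lra).
    apply Rle_trans with (INR (S k) * (Cmod (a (S k)) * rho ^ S k)).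
    - assert (Cmod z ^ k <= rho ^ k) by (apply pow_incr; unfold rho; lra).
      pose proof (Cmod_ge_0 (a (S k))). pose proof (pos_INR (S k)).
      simpl pred. simpl (rho ^ S k).
      replace (rho * (INR (S k) * (Cmod (a (S k)) * Cmod z ^ k)))
        with ((rho * INR (S k) * Cmod (a (S k))) * Cmod z ^ k) by ring.
      replace (INR (S k) * (Cmod (a (S k)) * (rho * rho ^ k)))
        with ((rho * INR (S k) * Cmod (a (S k))) * rho ^ k) by ring.
      apply Rmult_le_compat_l; [|assumption].
      apply Rmult_le_pos; [apply Rmult_le_pos|]; lra.
    - apply Rmult_le_compat; try apply pos_INR.
      + apply Rmult_le_pos; [apply Cmod_ge_0|apply pow_le; lra].
      + pose proof (pos_INR k). rewrite S_INR. nra.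
      + apply Hark. }
  { exists (K / rho * (q * L)). exact (rseries_scal (K / rho) _ _ HL'). }
  exists l, (K / rho ^ 2 * (q * L)), (rho - Cmod z).
  assert (HqL : 0 <= q * L).
  { apply is_series_Reals in HL'. eapply Rle_trans; [|apply (sum_incr _ 0 _ HL')].
    - simpl. lra.
    - intros k. apply Rmult_le_pos; apply pow_le; [apply pos_INR|lra]. }
  split; [unfold rho; lra|]. split.
  { apply Rmult_le_pos; [|assumption].
    apply Rlt_le, Rdiv_lt_0_compat; [|apply pow_lt]; lra. }
  split.
  { apply cseries_shift in Hl.
    replace (l - RtoC (INR 0) * (a 0%nat * z ^ pred 0))%C with l in Hl by (simpl; ring).
    eapply cseries_ext; [|exact Hl]. intros k. unfold deriv_coef. cbn [pred]. ring_C. }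
  intros h Hh.
  assert (Hzh : Cmod (z + h) <= rho).
  { pose proof (Cmod_triangle z h). lra. }
  rewrite taylor_on_disk_iff in Hf.
  assert (Hser : cseries (fun k => a k *
      ((z + h) ^ k - z ^ k - h * (RtoC (INR k) * z ^ pred k)))%C
      (f (z + h)%C - f z - h * l)%C).
  { eapply cseries_ext; [|apply cseries_minus; [apply cseries_minus;
      [apply Hf|apply Hf]|apply cseries_scal, Hl]].
    - intros k. ring_C.
    - unfold disk. lra.
    - exact Hz. }
  assert (HL2 := rseries_scal (K / rho ^ 2 * Cmod h ^ 2) _ _ HL').
  replace (K / rho ^ 2 * (q * L) * Cmod h ^ 2)
    with (K / rho ^ 2 * Cmod h ^ 2 * (q * L)) by ring.
  refine (cseries_Cmod_le _ _ _ _ Hser _ HL2).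
  intros k. cbv beta. rewrite Cmod_mult.
  pose proof (Cpow_remainder_le z h rho k ltac:(lra) ltac:(unfold rho; lra) Hzh) as HD.
  set (D := Cmod ((z + h) ^ k - z ^ k - h * (RtoC (INR k) * z ^ pred k))) in *.
  assert (Hr2 : 0 < rho ^ 2) by (apply pow_lt; lra).
  apply Rmult_le_reg_l with (rho ^ 2); [exact Hr2|].
  replace (rho ^ 2 * (K / rho ^ 2 * Cmod h ^ 2 * (INR k ^ 2 * q ^ k)))
    with (Cmod h ^ 2 * INR k ^ 2 * (K * q ^ k)) by (field; lra).
  apply Rle_trans with (Cmod (a k) * (Cmod h ^ 2 * (INR k ^ 2 * rho ^ k))).
  - replace (rho ^ 2 * (Cmod (a k) * D)) with (Cmod (a k) * (rho ^ 2 * D)) by ring.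
    apply Rmult_le_compat_l; [apply Cmod_ge_0|exact HD].
  - replace (Cmod (a k) * (Cmod h ^ 2 * (INR k ^ 2 * rho ^ k)))
      with (Cmod h ^ 2 * INR k ^ 2 * (Cmod (a k) * rho ^ k)) by ring.
    apply Rmult_le_compat_l; [|apply Hark].
    apply Rmult_le_pos; apply pow_le; [apply Cmod_ge_0|apply pos_INR].
Qed.

Lemma Cplus_minus_cancel (z y : C) : (z + (y - z))%C = y.
Proof. ring. Qed.

Lemma quadratic_is_derive (f : C -> C) (z l : C) K delta :
  0 < delta -> 0 <= K ->
  (forall h, Cmod h < delta -> Cmod (f (z + h)%C - f z - h * l) <= K * Cmod h ^ 2) ->
  @is_derive C_AbsRing C_NormedModule f z l.
Proof.
  intros Hd HK H. split.
  - apply is_linear_scal_l.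
  - intros x Hx eps.
    rewrite <- (@is_filter_lim_locally_unique C_AbsRing (AbsRing_NormedModule C_AbsRing) _ _ Hx).
    pose proof (cond_pos eps) as He.
    assert (Hm : 0 < Rmin delta (eps / (K + 1))).
    { apply Rmin_glb_lt; [exact Hd|]. apply Rdiv_lt_0_compat; lra. }
    exists (mkposreal _ Hm). intros y Hy.
    change (Cmod (y - z) < Rmin delta (eps / (K + 1))) in Hy.
    change (Cmod (f y - f z - (y - z) * l) <= eps * Cmod (y - z)).
    specialize (H (y - z)%C (Rlt_le_trans _ _ _ Hy (Rmin_l _ _))).
    rewrite (Cplus_minus_cancel z y) in H.
    eapply Rle_trans; [exact H|].
    pose proof (Rlt_le_trans _ _ _ Hy (Rmin_r _ _)) as Hy2.
    pose proof (Cmod_ge_0 (y - z)) as H0.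
    replace (K * Cmod (y - z) ^ 2) with (K * Cmod (y - z) * Cmod (y - z)) by ring.
    apply Rmult_le_compat_r; [exact H0|].
    apply Rmult_lt_compat_r with (r := K + 1) in Hy2; [|lra].
    field_simplify in Hy2; [|lra]. nra.
Qed.

Lemma taylor_is_derive a f z :
  taylor_on_disk a f -> disk z ->
  @is_derive C_AbsRing C_NormedModule f z (C_derive f z).
Proof.
  intros Hf Hz. destruct (taylor_quadratic a f z Hf Hz) as (l & K & d & Hd & HK & _ & H).
  pose proof (quadratic_is_derive f z l K d Hd HK H) as Hl.
  now rewrite (is_C_derive_unique f z l Hl).
Qed.

Lemma taylor_C_derive a f :
  taylor_on_disk a f -> taylor_on_disk (deriv_coef a) (C_derive f).
Proof.
  intros Hf. apply taylor_on_disk_iff. intros z Hz.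
  destruct (taylor_quadratic a f z Hf Hz) as (l & K & d & Hd & HK & Hs & H).
  rewrite (is_C_derive_unique f z l (quadratic_is_derive f z l K d Hd HK H)).
  exact Hs.
Qed.

(** ** Complex-valued functions of a real variable *)

(** Componentwise derivative: the form in which a holomorphic function, restricted to
    a segment, meets the mean value theorem of real analysis. *)
Definition is_Cderive (phi : R -> C) (t : R) (d : C) : Prop :=
  is_derive (fun s => fst (phi s)) t (fst d) /\
  is_derive (fun s => snd (phi s)) t (snd d).

Lemma is_derive_value (g : R -> R) (t d e : R) :
  is_derive g t d -> d = e -> is_derive g t e.
Proof. now intros H <-. Qed.

Lemma is_derive_of_bound (g : R -> R) (t d : R) :
  (forall eps, 0 < eps -> exists delta, 0 < delta /\
    forall s, Rabs (s - t) < delta -> Rabs (g s - g t - (s - t) * d) <= eps * Rabs (s - t)) ->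
  is_derive g t d.
Proof.
  intros H. split.
  - apply is_linear_scal_l.
  - intros x Hx eps.
    rewrite <- (@is_filter_lim_locally_unique R_AbsRing (AbsRing_NormedModule R_AbsRing) _ _ Hx).
    destruct (H eps (cond_pos eps)) as [d0 [Hd0 Hs]].
    exists (mkposreal d0 Hd0). intros s Hst. exact (Hs s Hst).
Qed.

Lemma is_Cderive_ray f (z : C) t l :
  @is_derive C_AbsRing C_NormedModule f (RtoC t * z)%C l ->
  is_Cderive (fun s => f (RtoC s * z)%C) t (z * l)%C.
Proof.
  intros [_ H].
  specialize (H (RtoC t * z)%C (fun P HP => HP)).
  assert (Hb : forall eps, 0 < eps -> exists delta, 0 < delta /\
    forall s, Rabs (s - t) < delta ->
      Cmod (f (RtoC s * z)%C - f (RtoC t * z)%C - RtoC (s - t) * (z * l))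
       <= eps * Rabs (s - t)).
  { intros eps He.
    pose proof (Cmod_ge_0 z) as Hz.
    assert (He' : 0 < eps / (Cmod z + 1)) by (apply Rdiv_lt_0_compat; lra).
    destruct (H (mkposreal _ He')) as [d Hd].
    exists (d / (Cmod z + 1)). pose proof (cond_pos d) as Hd0.
    split; [apply Rdiv_lt_0_compat; lra|].
    intros s Hs.
    assert (E : (RtoC s * z - RtoC t * z)%C = (RtoC (s - t) * z)%C)
      by (rewrite RtoC_minus; ring).
    assert (Em : Cmod (RtoC s * z - RtoC t * z) = Rabs (s - t) * Cmod z).
    { now rewrite E, Cmod_mult, Cmod_R. }
    specialize (Hd (RtoC s * z)%C).
    change (Cmod (RtoC s * z - RtoC t * z) < d ->
      Cmod (f (RtoC s * z)%C - f (RtoC t * z)%C - (RtoC s * z - RtoC t * z) * l)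
      <= eps / (Cmod z + 1) * Cmod (RtoC s * z - RtoC t * z)) in Hd.
    rewrite Em, E in Hd.
    pose proof (Rabs_pos (s - t)) as Ha.
    assert (Hs2 : Rabs (s - t) * (Cmod z + 1) < d).
    { apply Rmult_lt_compat_r with (r := Cmod z + 1) in Hs; [|lra].
      field_simplify in Hs; lra. }
    replace (RtoC (s - t) * (z * l))%C with (RtoC (s - t) * z * l)%C by ring.
    eapply Rle_trans; [apply Hd; nra|].
    replace (eps / (Cmod z + 1) * (Rabs (s - t) * Cmod z))
      with (eps * Rabs (s - t) * (Cmod z / (Cmod z + 1))) by (field; lra).
    rewrite <- (Rmult_1_r (eps * Rabs (s - t))) at 2.
    apply Rmult_le_compat_l; [nra|].
    apply Rmult_le_reg_r with (Cmod z + 1); [lra|]. field_simplify; lra. }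
  split; apply is_derive_of_bound; intros eps He;
    destruct (Hb eps He) as [d [Hd Hs]]; exists d; (split; [exact Hd|]);
    intros s Hst; (eapply Rle_trans; [|apply (Hs s Hst)]).
  - eapply Rle_trans; [|eapply Rle_trans; [apply Rmax_l|apply Rmax_Cmod]].
    apply Req_le. f_equal. simpl. ring.
  - eapply Rle_trans; [|eapply Rle_trans; [apply Rmax_r|apply Rmax_Cmod]].
    apply Req_le. f_equal. simpl. ring.
Qed.

Lemma is_Cderive_plus phi psi t d e :
  is_Cderive phi t d -> is_Cderive psi t e ->
  is_Cderive (fun s => phi s + psi s)%C t (d + e)%C.
Proof.
  intros [H1 H2] [H3 H4]. split; simpl.
  - exact (is_derive_plus _ _ _ _ _ H1 H3).
  - exact (is_derive_plus _ _ _ _ _ H2 H4).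
Qed.

Lemma is_Cderive_mult_real (u : R -> R) phi t du d :
  is_derive u t du -> is_Cderive phi t d ->
  is_Cderive (fun s => RtoC (u s) * phi s)%C t (RtoC du * phi t + RtoC (u t) * d)%C.
Proof.
  intros Hu [H1 H2].
  pose proof (is_derive_mult u _ t _ _ Hu H1 Rmult_comm) as E1.
  pose proof (is_derive_mult u _ t _ _ Hu H2 Rmult_comm) as E2.
  split.
  - eapply is_derive_ext; [|eapply is_derive_value; [exact E1|]].
    + intros s. simpl. change mult with Rmult. simpl. ring_R.
    + change mult with Rmult; change plus with Rplus. simpl. ring_R.
  - eapply is_derive_ext; [|eapply is_derive_value; [exact E2|]].
    + intros s. simpl. change mult with Rmult. simpl. ring_R.
    + change mult with Rmult; change plus with Rplus. simpl. ring_R.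
Qed.

Lemma is_Cderive_scal c phi t d :
  is_Cderive phi t d -> is_Cderive (fun s => c * phi s)%C t (c * d)%C.
Proof.
  intros [H1 H2]. split; simpl.
  - exact (is_derive_minus _ _ _ _ _ (is_derive_scal _ t (fst c) _ H1)
      (is_derive_scal _ t (snd c) _ H2)).
  - exact (is_derive_plus _ _ _ _ _ (is_derive_scal _ t (fst c) _ H2)
      (is_derive_scal _ t (snd c) _ H1)).
Qed.

Lemma is_Cderive_csum (phi : nat -> R -> C) (d : nat -> C) t n :
  (forall k, is_Cderive (phi k) t (d k)) ->
  is_Cderive (fun s => csum (fun k => phi k s) n) t (csum d n).
Proof.
  intros H. induction n as [|n IH]; simpl; [apply H|].
  now apply is_Cderive_plus.
Qed.

Lemma Cdot_le (x y : C) : fst x * fst y + snd x * snd y <= Cmod x * Cmod y.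
Proof.
  rewrite <- (Cmod_conj x), <- Cmod_mult.
  eapply Rle_trans; [|apply re_le_Cmod].
  eapply Rle_trans; [|apply Rle_abs].
  simpl. lra.
Qed.

(** Projecting onto the direction of the increment reduces the complex mean
    value inequality to monotonicity of a real function. *)
Lemma Cmean_value_le (phi dphi : R -> C) (M dM : R -> R) a b :
  a <= b ->
  (forall t, a <= t <= b -> is_Cderive phi t (dphi t)) ->
  (forall t, a <= t <= b -> is_derive M t (dM t)) ->
  (forall t, a <= t <= b -> Cmod (dphi t) <= dM t) ->
  Cmod (phi b - phi a) <= M b - M a.
Proof.
  intros Hab Hphi HM Hle.
  set (u := (phi b - phi a)%C).
  set (psi := fun t => Cmod u * M t - (fst u * fst (phi t) + snd u * snd (phi t))).
  set (dpsi := fun t => Cmod u * dM t - (fst u * fst (dphi t) + snd u * snd (dphi t))).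
  assert (Hpsi : forall t, a <= t <= b -> is_derive psi t (dpsi t)).
  { intros t Ht. destruct (Hphi t Ht) as [H1 H2].
    exact (is_derive_minus _ _ _ _ _ (is_derive_scal _ t (Cmod u) _ (HM t Ht))
      (is_derive_plus _ _ _ _ _ (is_derive_scal _ t (fst u) _ H1)
        (is_derive_scal _ t (snd u) _ H2))). }
  destruct (MVT_gen psi a b dpsi) as [c [Hc E]].
  { rewrite Rmin_left, Rmax_right by lra. intros x Hx. apply Hpsi. lra. }
  { rewrite Rmin_left, Rmax_right by lra. intros x Hx.
    apply derivable_continuous_pt. exists (dpsi x).
    apply is_derive_Reals. now apply Hpsi. }
  rewrite Rmin_left, Rmax_right in Hc by lra.
  assert (Hd : 0 <= dpsi c).
  { unfold dpsi. specialize (Hle c Hc).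
    pose proof (Cdot_le u (dphi c)) as H.
    pose proof (Rmult_le_compat_l _ _ _ (Cmod_ge_0 u) Hle). lra. }
  assert (Hsq : Cmod u ^ 2 = fst u * (fst (phi b) - fst (phi a)) + snd u * (snd (phi b) - snd (phi a))).
  { rewrite Cmod2_alt. unfold Re, Im, u. simpl. ring. }
  unfold psi in E.
  assert (H0 : Cmod u ^ 2 <= Cmod u * (M b - M a)) by nra.
  assert (Hmono : 0 <= M b - M a).
  { destruct (MVT_gen M a b dM) as [c' [Hc' E']].
    { rewrite Rmin_left, Rmax_right by lra. intros x Hx. apply HM. lra. }
    { rewrite Rmin_left, Rmax_right by lra. intros x Hx.
      apply derivable_continuous_pt. exists (dM x).
      apply is_derive_Reals. now apply HM. }
    rewrite Rmin_left, Rmax_right in Hc' by lra.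
    rewrite E'. apply Rmult_le_pos; [|lra].
    eapply Rle_trans; [apply Cmod_ge_0|now apply Hle]. }
  destruct (Cmod_ge_0 u) as [Hu|Hu]; [|lra].
  apply Rmult_le_reg_l with (Cmod u); [exact Hu|].
  replace (Cmod u * Cmod u) with (Cmod u ^ 2) by ring. exact H0.
Qed.

(** * Landau's bound for the partial sums of the coefficients *)

(** The Taylor coefficients [binomial (2 k) k / 4 ^ k] of [(1 - z) ^ (- 1 / 2)]. *)
Fixpoint landau_coef (k : nat) : R :=
  match k with
  | O => 1
  | S j => landau_coef j * ((2 * INR j + 1) / (2 * INR j + 2))
  end.

Lemma landau_coef_S k :
  2 * INR (S k) * landau_coef (S k) = (2 * INR k + 1) * landau_coef k.
Proof.
  pose proof (pos_INR k). rewrite S_INR. simpl. field. lra.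
Qed.

Lemma sum_f_R0_reverse (u : nat -> R) n :
  sum_f_R0 (fun i => u (n - i)%nat) n = sum_f_R0 u n.
Proof.
  revert u. induction n as [|n IH]; intros u; [reflexivity|].
  rewrite (decomp_sum (fun i => u (S n - i)%nat)) by lia.
  simpl pred. rewrite (sum_eq _ (fun i => u (n - i)%nat)).
  - rewrite IH, Nat.sub_0_r. simpl. ring.
  - reflexivity.
Qed.

(** The square of [(1 - z) ^ (- 1 / 2)] is [1 / (1 - z)].  By symmetry the factor [i]
    may be replaced by its mean [m / 2] inside the convolution; the recurrence of
    [landau_coef_S] then reads [(m + 1) * c (m + 1) = (m + 1) * c m] for the
    convolution [c]. *)
Lemma landau_convolution m :
  sum_f_R0 (fun i => landau_coef i * landau_coef (m - i)) m = 1.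
Proof.
  set (conv := fun m => sum_f_R0 (fun i => landau_coef i * landau_coef (m - i)) m).
  assert (Hsym : forall m,
    2 * sum_f_R0 (fun i => INR i * (landau_coef i * landau_coef (m - i))) m
    = INR m * conv m).
  { clear m. intros m.
    replace (2 * sum_f_R0 (fun i => INR i * (landau_coef i * landau_coef (m - i))) m)
      with (sum_f_R0 (fun i => INR i * (landau_coef i * landau_coef (m - i))) m
        + sum_f_R0 (fun i => INR i * (landau_coef i * landau_coef (m - i))) m) by ring.
    rewrite <- (sum_f_R0_reverse _ m) at 2.
    rewrite <- plus_sum. unfold conv. rewrite scal_sum.
    apply sum_eq. intros i Hi.
    replace (m - (m - i))%nat with i by lia.
    rewrite minus_INR by exact Hi. ring. }
  induction m as [|m IH]; [simpl; ring|].
  assert (Hm : 0 < INR (S m)) by (apply lt_0_INR; lia).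
  apply Rmult_eq_reg_l with (INR (S m)); [|lra].
  change (INR (S m) * conv (S m) = INR (S m) * 1). rewrite <- Hsym.
  rewrite decomp_sum by lia. rewrite INR_0, Rmult_0_l, Rplus_0_l. simpl pred.
  rewrite scal_sum.
  rewrite (sum_eq _ (fun i => INR i * (landau_coef i * landau_coef (m - i)) * 2
     + landau_coef i * landau_coef (m - i))).
  - rewrite plus_sum, <- scal_sum, Hsym. unfold conv. rewrite IH, S_INR. ring.
  - intros i Hi. replace (S m - S i)%nat with (m - i)%nat by lia.
    replace (INR (S i) * (landau_coef (S i) * landau_coef (m - i)) * 2)
      with (2 * INR (S i) * landau_coef (S i) * landau_coef (m - i)) by ring.
    rewrite landau_coef_S. ring.
Qed.

Lemma landau_coef_pos k : 0 < landau_coef k.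
Proof.
  induction k as [|k IH]; simpl; [lra|].
  pose proof (pos_INR k). apply Rmult_lt_0_compat; [exact IH|].
  apply Rdiv_lt_0_compat; lra.
Qed.

(** This is what keeps the loss in Landau's inequality logarithmic. *)
Lemma landau_coef_sqr_le k : landau_coef k ^ 2 <= / INR (S k).
Proof.
  induction k as [|k IH]; [simpl; lra|].
  pose proof (pos_INR k) as Hk. rewrite (S_INR (S k)). rewrite S_INR in *.
  change (landau_coef (S k))
    with (landau_coef k * ((2 * INR k + 1) / (2 * INR k + 2))).
  rewrite Rpow_mult_distr.
  set (x := INR k) in *.
  apply Rle_trans with (/ (x + 1) * ((2 * x + 1) / (2 * x + 2)) ^ 2).
  - apply Rmult_le_compat_r; [apply pow2_ge_0|exact IH].
  - apply Rmult_le_reg_r with ((x + 1) * (2 * x + 2) ^ 2 * (x + 1 + 1)).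
    + repeat apply Rmult_lt_0_compat; lra.
    + field_simplify; [|lra|lra]. nra.
Qed.

(** ** Averages over roots of unity *)

Definition unit_root (n : nat) : C :=
  (cos (2 * PI / INR (S n)), sin (2 * PI / INR (S n))).

Lemma unit_root_pow n k :
  (unit_root n ^ k)%C
  = (cos (INR k * (2 * PI / INR (S n))), sin (INR k * (2 * PI / INR (S n)))).
Proof.
  induction k as [|k IH].
  - simpl. rewrite Rmult_0_l, cos_0, sin_0. reflexivity.
  - change ((unit_root n ^ S k)%C) with (unit_root n * unit_root n ^ k)%C.
    rewrite IH, (S_INR k). set (t := 2 * PI / INR (S n)).
    replace ((INR k + 1) * t) with (t + INR k * t) by ring.
    rewrite cos_plus, sin_plus. unfold unit_root. fold t.
    unfold Cmult. simpl. f_equal; ring.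
Qed.

Lemma unit_root_conj n : (unit_root n * Cconj (unit_root n))%C = RtoC 1.
Proof.
  unfold unit_root, Cconj, Cmult, RtoC. simpl.
  set (t := 2 * PI / _). pose proof (sin2_cos2 t) as H. unfold Rsqr in H.
  f_equal; [lra|ring].
Qed.

Lemma Cmod_unit_root_pow n k : Cmod (unit_root n ^ k) = 1.
Proof.
  rewrite unit_root_pow. unfold Cmod. simpl.
  set (t := INR k * _). pose proof (sin2_cos2 t) as H. unfold Rsqr in H.
  replace (cos t * (cos t * 1) + sin t * (sin t * 1)) with 1 by lra.
  apply sqrt_1.
Qed.

Lemma unit_root_period n : (unit_root n ^ S n)%C = RtoC 1.
Proof.
  rewrite unit_root_pow. pose proof (lt_0_INR (S n) ltac:(lia)).
  replace (INR (S n) * (2 * PI / INR (S n))) with (2 * PI) by (field; lra).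
  now rewrite cos_2PI, sin_2PI.
Qed.

Lemma unit_root_neq_1 n d : (0 < d < S n)%nat -> (unit_root n ^ d)%C <> RtoC 1.
Proof.
  intros Hd E. rewrite unit_root_pow in E.
  set (t := INR d * (PI / INR (S n))).
  assert (Et : cos (2 * t) = 1).
  { replace (2 * t) with (INR d * (2 * PI / INR (S n)))
      by (unfold t; field; apply not_0_INR; lia).
    exact (f_equal fst E). }
  rewrite cos_2a_sin in Et. clear E.
  assert (Hs : 0 < sin t).
  { pose proof PI_RGT_0 as Hpi.
    assert (Hn : 0 < INR (S n)) by (apply lt_0_INR; lia).
    assert (0 < INR d) by (apply lt_0_INR; lia).
    assert (INR d < INR (S n)) by (apply lt_INR; lia).
    apply sin_gt_0.
    - unfold t. apply Rmult_lt_0_compat; [assumption|].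
      apply Rdiv_lt_0_compat; lra.
    - unfold t. apply Rmult_lt_reg_r with (INR (S n)); [assumption|].
      replace (INR d * (PI / INR (S n)) * INR (S n)) with (INR d * PI)
        by (field; lra).
      nra. }
  nra.
Qed.

Lemma csum_geom (q : C) n :
  ((q - 1) * csum (fun j => q ^ j) n)%C = (q ^ S n - 1)%C.
Proof.
  induction n as [|n IH]; [simpl; ring|].
  cbn [csum]. rewrite Cmult_plus_distr_l, IH. simpl. ring.
Qed.

Lemma Cpow_comm (z : C) a b : ((z ^ a) ^ b)%C = ((z ^ b) ^ a)%C.
Proof. now rewrite <- !Cpow_mult_r, Nat.mul_comm. Qed.

(** A geometric sum whose ratio is a root of unity, equal to [1] only for [m = k]. *)
Lemma unit_root_orthogonal n m k :
  (m < S n)%nat -> (k < S n)%nat ->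
  csum (fun j => (unit_root n ^ j) ^ m * Cconj (unit_root n ^ j) ^ k)%C n
  = if Nat.eqb m k then RtoC (INR (S n)) else RtoC 0.
Proof.
  intros Hm Hk. set (w := unit_root n).
  set (q := (w ^ m * Cconj w ^ k)%C).
  assert (Hq : forall j, ((w ^ j) ^ m * Cconj (w ^ j) ^ k)%C = (q ^ j)%C).
  { intros j. unfold q. rewrite Cpow_mult_l, !(Cpow_conj w j), !(Cpow_comm _ j).
    reflexivity. }
  rewrite (csum_ext _ (fun j => q ^ j)%C) by (intros; apply Hq).
  assert (Hww : forall i, (w ^ i * Cconj w ^ i)%C = RtoC 1).
  { intros i. rewrite <- Cpow_mult_l. unfold w. rewrite unit_root_conj. apply Cpow_1_l. }
  destruct (Nat.eqb_spec m k) as [->|Hne].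
  - unfold q. rewrite Hww.
    rewrite (csum_ext _ (fun _ => RtoC 1)) by (intros; apply Cpow_1_l).
    rewrite csum_RtoC. f_equal. rewrite sum_cte. ring.
  - assert (Hq1 : (q - 1)%C <> RtoC 0).
    { intros E. assert (Eq : q = RtoC 1)
        by (replace q with (q - 1 + 1)%C by ring; rewrite E; ring).
      unfold q in Eq. destruct (Nat.lt_total m k) as [H|[H|H]]; [|lia|].
      - replace k with (m + (k - m))%nat in Eq by lia.
        rewrite Cpow_add_r, Cmult_assoc, Hww, Cmult_1_l, <- Cpow_conj in Eq.
        apply (unit_root_neq_1 n (k - m)); [lia|]. fold w.
        rewrite <- (Cconj_conj (w ^ (k - m))), Eq.
        unfold Cconj, RtoC. simpl. f_equal. ring.
      - replace m with ((m - k) + k)%nat in Eq by lia.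
        rewrite Cpow_add_r, <- Cmult_assoc, Hww, Cmult_1_r in Eq.
        apply (unit_root_neq_1 n (m - k)); [lia|]. exact Eq. }
    assert (HqM : (q ^ S n)%C = RtoC 1).
    { unfold q. rewrite Cpow_mult_l, !(Cpow_comm _ _ (S n)), <- Cpow_conj.
      unfold w. rewrite unit_root_period.
      replace (Cconj 1) with (RtoC 1) by (unfold Cconj, RtoC; simpl; f_equal; ring).
      rewrite !Cpow_1_l. ring. }
    pose proof (csum_geom q n) as Hg. rewrite HqM in Hg.
    replace (RtoC 1 - 1)%C with (RtoC 0) in Hg by ring.
    destruct (Ceq_dec (csum (fun j => q ^ j)%C n) 0) as [E|E]; [exact E|].
    exfalso. apply (Cmult_neq_0 _ _ Hq1 E Hg).
Qed.

(** Let [P] be the Taylor polynomial of degree [N] of [(1 - z) ^ (- 1 / 2)].  As [P ^ 2]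
    agrees with [1 / (1 - z)] up to degree [N], the coefficient of [z ^ N] in
    [a (z) * P (z) ^ 2] is the partial sum [a_0 + ... + a_N].  With more nodes than
    the degree [T + 2 * N] of this product, the mean over roots of unity extracts
    that coefficient without aliasing.  The radius [rho] only rescales [a] and [P]. *)
Lemma landau_filter (a : nat -> C) (rho : R) T N :
  (N <= T)%nat ->
  let M := (T + 2 * N)%nat in
  csum (fun j =>
    csum (fun k => (a k * RtoC rho ^ k) * (unit_root M ^ j) ^ k) T
    * csum (fun i => RtoC (landau_coef i * rho ^ i) * (unit_root M ^ j) ^ i) N
    * csum (fun l => RtoC (landau_coef l * rho ^ l) * (unit_root M ^ j) ^ l) N
    * Cconj (unit_root M ^ j) ^ N)%C M
  = (RtoC (INR (S M)) * (RtoC rho ^ N * csum a N))%C.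
Proof.
  intros HNT M.
  set (c := fun k i l : nat => (RtoC rho ^ (k + i + l) * a k
              * RtoC (landau_coef i * landau_coef l))%C).
  set (E := fun j s : nat => ((unit_root M ^ j) ^ s * Cconj (unit_root M ^ j) ^ N)%C).
  transitivity (csum (fun j => csum (fun k => csum (fun i => csum (fun l =>
    c k i l * E j (k + i + l)%nat)%C N) N) T) M).
  { apply csum_ext. intros j _. set (x := (unit_root M ^ j)%C).
    set (P := csum (fun i => RtoC (landau_coef i * rho ^ i) * x ^ i)%C N).
    symmetry. set (v := (Cconj x ^ N)%C).
    rewrite (csum_ext _ (fun k => (P * P * v) * ((a k * RtoC rho ^ k) * x ^ k))%C);
      [rewrite csum_scal; ring|].
    intros k _.
    rewrite (csum_ext _ (fun i => (P * v * ((a k * RtoC rho ^ k) * x ^ k))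
      * (RtoC (landau_coef i * rho ^ i) * x ^ i))%C);
      [rewrite csum_scal; unfold P; ring|].
    intros i _.
    rewrite (csum_ext _ (fun l => (v * ((a k * RtoC rho ^ k) * x ^ k)
      * (RtoC (landau_coef i * rho ^ i) * x ^ i))
      * (RtoC (landau_coef l * rho ^ l) * x ^ l))%C);
      [rewrite csum_scal; unfold P; ring|].
    intros l _. unfold c, E. fold x v.
    rewrite !Cpow_add_r, !RtoC_mult, !RtoC_pow. ring. }
  rewrite csum_switch.
  rewrite (csum_ext _ (fun k => RtoC (INR (S M)) * (RtoC rho ^ N
    * (if Nat.leb k N then a k else RtoC 0)))%C).
  { now rewrite !csum_scal, csum_truncate by exact HNT. }
  intros k Hk. rewrite csum_switch.
  assert (Hin : forall i, (i <= N)%nat ->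
    csum (fun j => csum (fun l => c k i l * E j (k + i + l)%nat)%C N) M
    = if Nat.leb (k + i) N
      then (RtoC (INR (S M)) * c k i (N - (k + i))%nat)%C else RtoC 0).
  { intros i Hi. rewrite csum_switch.
    rewrite (csum_ext _ (fun l => if Nat.eqb (k + i + l) N
       then (RtoC (INR (S M)) * c k i l)%C else RtoC 0)).
    - destruct (Nat.leb_spec (k + i) N) as [H|H].
      + rewrite (csum_ext _ (fun l => if Nat.eqb l (N - (k + i))
          then (RtoC (INR (S M)) * c k i l)%C else RtoC 0)).
        * rewrite csum_delta by lia. reflexivity.
        * intros l _. destruct (Nat.eqb_spec (k + i + l) N);
            destruct (Nat.eqb_spec l (N - (k + i))); (reflexivity || lia).
      + apply csum_0. intros l _.
        destruct (Nat.eqb_spec (k + i + l) N); [lia|reflexivity].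
    - intros l Hl. rewrite csum_scal. unfold E.
      rewrite unit_root_orthogonal by (unfold M; lia).
      destruct (Nat.eqb (k + i + l) N); ring. }
  rewrite (csum_ext _ _ _ Hin).
  destruct (Nat.leb_spec k N) as [H|H].
  - rewrite (csum_ext _ (fun i => if Nat.leb i (N - k) then
      (RtoC (INR (S M)) * (RtoC rho ^ N * a k)) *
        RtoC (landau_coef i * landau_coef (N - k - i)) else RtoC 0)%C).
    + rewrite csum_truncate by lia. rewrite csum_scal, csum_RtoC, landau_convolution.
      ring.
    + intros i Hi. destruct (Nat.leb_spec (k + i) N);
        destruct (Nat.leb_spec i (N - k)); try lia; [|reflexivity].
      unfold c. replace (k + i + (N - (k + i)))%nat with N by lia.
      replace (N - (k + i))%nat with (N - k - i)%nat by lia. ring.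
  - rewrite csum_0; [ring|]. intros i _.
    destruct (Nat.leb_spec (k + i) N); [lia|reflexivity].
Qed.

(** Parseval's identity for [P (rho z)], followed by [rho <= 1]. *)
Lemma landau_parseval (rho : R) M N :
  (N <= M)%nat -> 0 < rho <= 1 ->
  sum_f_R0 (fun j => Cmod (csum (fun i =>
      RtoC (landau_coef i * rho ^ i) * (unit_root M ^ j) ^ i)%C N) ^ 2) M
  <= INR (S M) * sum_f_R0 (fun i => landau_coef i ^ 2) N.
Proof.
  intros HNM HR.
  set (q := fun i => landau_coef i * rho ^ i).
  assert (E : RtoC (sum_f_R0 (fun j => Cmod (csum (fun i =>
      RtoC (q i) * (unit_root M ^ j) ^ i)%C N) ^ 2) M)
    = RtoC (INR (S M) * sum_f_R0 (fun i => q i ^ 2) N)).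
  { rewrite <- csum_RtoC.
    transitivity (csum (fun j => csum (fun i => csum (fun l => RtoC (q i * q l) *
      ((unit_root M ^ j) ^ i * Cconj (unit_root M ^ j) ^ l))%C N) N) M).
    - apply csum_ext. intros j _. set (x := (unit_root M ^ j)%C).
      set (P := csum (fun i => RtoC (q i) * x ^ i)%C N).
      rewrite Cmod2_conj.
      assert (HP : Cconj P = csum (fun i => RtoC (q i) * Cconj x ^ i)%C N).
      { unfold P. generalize N as n. intros n. induction n as [|n IH]; cbn [csum].
        - unfold Cconj, Cmult, RtoC. simpl. f_equal; ring.
        - rewrite <- IH, <- Cpow_conj. unfold Cconj, Cplus, Cmult. simpl. f_equal; ring. }
      symmetry.
      rewrite (csum_ext _ (fun i => Cconj P * (RtoC (q i) * x ^ i))%C);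
        [rewrite csum_scal; unfold P; ring|].
      intros i _.
      rewrite (csum_ext _ (fun l => (RtoC (q i) * x ^ i) * (RtoC (q l) * Cconj x ^ l))%C);
        [rewrite csum_scal, <- HP; ring|].
      intros l _. rewrite RtoC_mult. ring.
    - rewrite csum_switch, RtoC_mult, <- csum_RtoC, <- csum_scal.
      apply csum_ext. intros i Hi. rewrite csum_switch.
      rewrite (csum_ext _ (fun l => if Nat.eqb l i
        then (RtoC (INR (S M)) * RtoC (q i * q l))%C else RtoC 0)).
      + rewrite csum_delta by lia. f_equal. f_equal. ring.
      + intros l Hl. rewrite csum_scal, unit_root_orthogonal by lia.
        rewrite (Nat.eqb_sym l i). destruct (Nat.eqb i l); ring. }
  apply RtoC_inj in E. unfold q in E. rewrite E.
  apply Rmult_le_compat_l; [apply pos_INR|].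
  apply sum_Rle. intros i _.
  pose proof (landau_coef_pos i). apply pow_incr. split.
  - apply Rmult_le_pos; [lra|apply pow_le; lra].
  - rewrite <- (Rmult_1_r (landau_coef i)) at 2. apply Rmult_le_compat_l; [lra|].
    rewrite <- (pow1 i). apply pow_incr. lra.
Qed.

(** Landau's inequality: the kernel [P ^ 2] has the modulus of a square, so its mean
    is a sum of squares by Parseval, in place of the mean of the modulus of a
    Dirichlet kernel. *)
Lemma landau_polynomial (a : nat -> C) (rho B : R) T N :
  (N <= T)%nat -> 0 < rho <= 1 ->
  (forall w, Cmod w = rho -> Cmod (csum (fun k => a k * w ^ k)%C T) <= B) ->
  rho ^ N * Cmod (csum a N) <= B * sum_f_R0 (fun i => landau_coef i ^ 2) N.
Proof.
  intros HNT HR HB.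
  pose proof (landau_filter a rho T N HNT) as E. cbv zeta in E.
  set (M := (T + 2 * N)%nat) in *.
  assert (HM : 0 < INR (S M)) by (apply lt_0_INR; lia).
  assert (HB0 : 0 <= B).
  { eapply Rle_trans; [apply Cmod_ge_0|apply (HB (RtoC rho))].
    rewrite Cmod_R, Rabs_pos_eq; lra. }
  apply Rmult_le_reg_l with (INR (S M)); [exact HM|].
  replace (INR (S M) * (rho ^ N * Cmod (csum a N)))
    with (Cmod (RtoC (INR (S M)) * (RtoC rho ^ N * csum a N))).
  2:{ rewrite !Cmod_mult, Cmod_pow, !Cmod_R, !Rabs_pos_eq by lra. reflexivity. }
  rewrite <- E.
  eapply Rle_trans; [apply Cmod_csum|].
  apply Rle_trans with (sum_f_R0 (fun j => Cmod (csum (fun i =>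
      RtoC (landau_coef i * rho ^ i) * (unit_root M ^ j) ^ i)%C N) ^ 2 * B) M).
  - apply sum_Rle. intros j _.
    rewrite !Cmod_mult, Cmod_pow, Cmod_conj, Cmod_unit_root_pow, pow1, Rmult_1_r.
    set (P := Cmod (csum (fun i => RtoC (landau_coef i * rho ^ i) * _)%C N)).
    rewrite Rmult_assoc, Rmult_comm. simpl (P ^ 2). rewrite Rmult_1_r.
    apply Rmult_le_compat_l; [apply Rmult_le_pos; apply Cmod_ge_0|].
    rewrite (csum_ext _ (fun k => a k * (RtoC rho * unit_root M ^ j) ^ k)%C).
    + apply HB. rewrite Cmod_mult, Cmod_unit_root_pow, Cmod_R, Rabs_pos_eq; lra.
    + intros k _. rewrite Cpow_mult_l. ring.
  - rewrite <- scal_sum.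
    replace (INR (S M) * (B * sum_f_R0 (fun i => landau_coef i ^ 2) N))
      with (B * (INR (S M) * sum_f_R0 (fun i => landau_coef i ^ 2) N)) by ring.
    apply Rmult_le_compat_l; [exact HB0|].
    apply landau_parseval; [unfold M; lia|exact HR].
Qed.

(** * Real powers *)

Lemma Rpower_pos x y : 0 < Rpower x y.
Proof. apply exp_pos. Qed.

Lemma Rpower_pred x c : 0 < x -> Rpower x (c - 1) = Rpower x c / x.
Proof.
  intros Hx. unfold Rminus. rewrite Rpower_plus, Rpower_Ropp, Rpower_1 by exact Hx.
  reflexivity.
Qed.

Lemma Rpower_opp_le x y c : 0 < x <= y -> 0 <= c -> Rpower y (- c) <= Rpower x (- c).
Proof.
  intros Hxy Hc. rewrite !Rpower_Ropp.
  apply Rinv_le_contravar; [apply Rpower_pos|].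
  apply Rle_Rpower_l; [exact Hc|exact Hxy].
Qed.

Lemma Rpower_ge_1 x c : 1 <= x -> 0 <= c -> 1 <= Rpower x c.
Proof.
  intros Hx Hc. rewrite <- (Rpower_O x) by lra. apply Rle_Rpower; lra.
Qed.

Lemma is_derive_Rpower_affine (m b c t : R) :
  0 < b + m * t ->
  is_derive (fun s => Rpower (b + m * s) c) t (m * c * Rpower (b + m * t) (c - 1)).
Proof.
  intros H. rewrite Rpower_pred by exact H. unfold Rpower.
  auto_derive; [exact H|]. field. lra.
Qed.

Lemma Rpower_mean_value x c :
  0 < x -> exists y, x <= y <= x + 1 /\
    Rpower (x + 1) c - Rpower x c = c * Rpower y (c - 1).
Proof.
  intros Hx.
  assert (Hd : forall t, 0 < t -> is_derive (fun s => Rpower s c) t (c * Rpower t (c - 1))).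
  { intros t Ht. rewrite Rpower_pred by exact Ht. unfold Rpower.
    auto_derive; [exact Ht|]. field. lra. }
  destruct (MVT_gen (fun s => Rpower s c) x (x + 1) (fun t => c * Rpower t (c - 1)))
    as [y [Hy E]].
  - rewrite Rmin_left, Rmax_right by lra. intros t Ht. apply Hd. lra.
  - rewrite Rmin_left, Rmax_right by lra. intros t Ht.
    apply derivable_continuous_pt. eexists. apply is_derive_Reals. apply Hd. lra.
  - rewrite Rmin_left, Rmax_right in Hy by lra. exists y. split; [exact Hy|].
    rewrite E. ring.
Qed.

(** The mean value theorem gives [d / (x + 1) <= (x + 1) ^ d - x ^ d] for [x >= 1],
    and the right-hand sides telescope. *)
Lemma harmonic_sum_le d N :
  0 < d <= 1 ->
  sum_f_R0 (fun k => / INR (S k)) N <= Rpower (INR (S N)) d / d.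
Proof.
  intros Hd. induction N as [|N IH].
  - simpl. rewrite Rinv_1. unfold Rpower. rewrite ln_1, Rmult_0_r, exp_0.
    apply Rmult_le_reg_r with d; [lra|]. field_simplify; lra.
  - change (sum_f_R0 (fun k => / INR (S k)) (S N))
      with (sum_f_R0 (fun k => / INR (S k)) N + / INR (S (S N))).
    rewrite (S_INR (S N)).
    assert (Hx : 1 <= INR (S N)) by (rewrite S_INR; pose proof (pos_INR N); lra).
    set (x := INR (S N)) in *.
    destruct (Rpower_mean_value x d ltac:(lra)) as [y [Hy E]].
    rewrite Rpower_pred in E by lra.
    assert (Hy1 : / (x + 1) <= Rpower y d / y).
    { apply Rle_trans with (1 * / y).
      - rewrite Rmult_1_l. apply Rinv_le_contravar; lra.
      - apply Rmult_le_compat_r; [apply Rlt_le, Rinv_0_lt_compat; lra|].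
        apply Rpower_ge_1; lra. }
    replace (Rpower (x + 1) d / d) with (Rpower x d / d + Rpower y d / y).
    + lra.
    + replace (Rpower (x + 1) d) with (Rpower x d + d * (Rpower y d / y)) by lra.
      field. lra.
Qed.

Lemma ex_series_bounded (u : nat -> R) B :
  (forall k, 0 <= u k) -> (forall n, sum_f_R0 u n <= B) -> ex_series u.
Proof.
  intros Hu HB.
  destruct (ex_finite_lim_seq_incr (sum_n u) B) as [l Hl].
  - intros n. rewrite sum_Sn. specialize (Hu (S n)).
    change (sum_n u n <= sum_n u n + u (S n)). lra.
  - intros n. rewrite sum_n_Reals. apply HB.
  - now exists l.
Qed.

(** Comparison with the telescoping series of the differences of [k ^ (- eta) / eta]. *)
Lemma ex_series_Rpower eta :
  0 < eta -> ex_series (fun k => Rpower (INR (S k)) (- (1 + eta))).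
Proof.
  intros He. apply ex_series_incr_1.
  apply (ex_series_bounded _ (Rpower 1 (- eta) / eta)).
  { intros k. apply Rlt_le, Rpower_pos. }
  intros n.
  apply Rle_trans with (Rpower 1 (- eta) / eta - Rpower (INR (S (S n))) (- eta) / eta).
  2:{ pose proof (Rdiv_lt_0_compat _ _ (Rpower_pos (INR (S (S n))) (- eta)) He). lra. }
  assert (Hstep : forall k, Rpower (INR (S (S k))) (- (1 + eta))
    <= Rpower (INR (S k)) (- eta) / eta - Rpower (INR (S (S k))) (- eta) / eta).
  { intros k. rewrite (S_INR (S k)).
    assert (Hx : 1 <= INR (S k)) by (rewrite S_INR; pose proof (pos_INR k); lra).
    set (x := INR (S k)) in *.
    destruct (Rpower_mean_value x (- eta) ltac:(lra)) as [y [Hy E]].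
    replace (Rpower x (- eta) / eta - Rpower (x + 1) (- eta) / eta)
      with (Rpower y (- (1 + eta))).
    - apply Rpower_opp_le; lra.
    - replace (- (1 + eta)) with (- eta - 1) by ring.
      apply Rmult_eq_reg_l with eta; [|lra].
      replace (eta * (Rpower x (- eta) / eta - Rpower (x + 1) (- eta) / eta))
        with (Rpower x (- eta) - Rpower (x + 1) (- eta)) by (field; lra).
      lra. }
  induction n as [|n IH].
  - exact (Hstep O).
  - rewrite tech5. specialize (Hstep (S n)). lra.
Qed.

Lemma Rpower_opp_small eta eps :
  0 < eta -> 0 < eps ->
  exists N, forall n, (N <= n)%nat -> Rpower (INR (S n)) (- eta) < eps.
Proof.
  intros He Heps.
  destruct (INR_unbounded (exp (- ln eps / eta))) as [N HN].
  exists N. intros n Hn.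
  assert (Hn' : INR N <= INR n) by now apply le_INR.
  pose proof (exp_pos (- ln eps / eta)).
  unfold Rpower. rewrite <- (exp_ln eps) at 1 by exact Heps.
  apply exp_increasing.
  assert (Hl : - ln eps / eta < ln (INR (S n))).
  { rewrite <- (ln_exp (- ln eps / eta)). apply ln_increasing; [assumption|].
    rewrite S_INR. lra. }
  apply Rmult_lt_compat_l with (r := eta) in Hl; [|exact He].
  replace (eta * (- ln eps / eta)) with (- ln eps) in Hl by (field; lra). lra.
Qed.

(** * Growth of functions with controlled derivative *)

Definition deriv_bound (alpha A : R) (f : C -> C) : Prop :=
  forall z, disk z -> Cmod (C_derive f z) <= A * Rpower (1 - Cmod z ^ 2) (- alpha).

Lemma deriv_bound_nonneg alpha A f : deriv_bound alpha A f -> 0 <= A.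
Proof.
  intros H. specialize (H (RtoC 0)). unfold disk in H. rewrite Cmod_0 in H.
  specialize (H Rlt_0_1). pose proof (Cmod_ge_0 (C_derive f 0)).
  replace (1 - 0 ^ 2) with 1 in H by ring.
  unfold Rpower in H. rewrite ln_1, Rmult_0_r, exp_0 in H. lra.
Qed.

(** Integrate the bound for the derivative along the radius through [z], after
    weakening [1 - t ^ 2 * |z| ^ 2] to [1 - t * |z|] so that the primitive is explicit. *)
Lemma deriv_bound_growth a f alpha A :
  taylor_on_disk a f -> 1 < alpha -> deriv_bound alpha A f ->
  forall z, disk z ->
    Cmod (f z - f (RtoC 0)) <= A / (alpha - 1) * Rpower (1 - Cmod z) (- (alpha - 1)).
Proof.
  intros Hf Ha HA z Hz. pose proof (deriv_bound_nonneg _ _ _ HA) as HA0.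
  unfold disk in Hz. pose proof (Cmod_ge_0 z) as Hz0.
  set (r := Cmod z) in *.
  assert (Hdisk : forall t, 0 <= t <= 1 -> Cmod (RtoC t * z) = t * r).
  { intros t Ht. rewrite Cmod_mult, Cmod_R, Rabs_pos_eq by lra. reflexivity. }
  pose proof (Cmean_value_le (fun t => f (RtoC t * z)%C)
    (fun t => z * C_derive f (RtoC t * z))%C
    (fun t => A / (alpha - 1) * Rpower (1 + (- r) * t) (- (alpha - 1)))
    (fun t => A / (alpha - 1) * ((- r) * (- (alpha - 1)) *
       Rpower (1 + (- r) * t) (- (alpha - 1) - 1))) 0 1 Rle_0_1) as H.
  cbv beta in H.
  replace (RtoC 1 * z)%C with z in H by ring.
  replace (RtoC 0 * z)%C with (RtoC 0) in H by ring.
  eapply Rle_trans; [apply H; clear H|].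
  - intros t Ht. apply is_Cderive_ray. apply (taylor_is_derive a); [exact Hf|].
    unfold disk. rewrite Hdisk by exact Ht. nra.
  - intros t Ht. apply is_derive_scal, is_derive_Rpower_affine. nra.
  - intros t Ht. rewrite Cmod_mult. fold r.
    assert (Ht1 : 0 <= t * r < 1) by nra.
    replace (A / (alpha - 1) * (- r * - (alpha - 1) *
       Rpower (1 + - r * t) (- (alpha - 1) - 1)))
      with (r * (A * Rpower (1 - t * r) (- alpha))).
    2:{ replace (1 + - r * t) with (1 - t * r) by ring.
        replace (- (alpha - 1) - 1) with (- alpha) by ring. field. lra. }
    apply Rmult_le_compat_l; [exact Hz0|].
    eapply Rle_trans; [apply HA; unfold disk; rewrite Hdisk; lra|].
    rewrite Hdisk by exact Ht.
    apply Rmult_le_compat_l; [exact HA0|]. apply Rpower_opp_le; nra.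
  - replace (1 + - r * 1) with (1 - r) by ring.
    assert (0 <= A / (alpha - 1) * Rpower (1 + - r * 0) (- (alpha - 1))).
    { apply Rmult_le_pos; [|apply Rlt_le, Rpower_pos].
      apply Rmult_le_pos; [exact HA0|]. apply Rlt_le, Rinv_0_lt_compat. lra. }
    lra.
Qed.

Lemma bernoulli_minus x n : 0 <= x <= 1 -> 1 - INR n * x <= (1 - x) ^ n.
Proof.
  intros Hx. induction n as [|n IH]; [simpl; lra|].
  rewrite S_INR. change ((1 - x) ^ S n) with ((1 - x) * (1 - x) ^ n).
  pose proof (pos_INR n).
  apply Rle_trans with ((1 - x) * (1 - INR n * x)); [nra|].
  apply Rmult_le_compat_l; lra.
Qed.

Lemma taylor_uniform_on_circle a f rho eps N :
  taylor_on_disk a f -> 0 < rho < 1 -> 0 < eps ->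
  exists T, (N <= T)%nat /\ forall w, Cmod w = rho ->
    Cmod (csum (fun k => a k * w ^ k)%C T - f w) <= eps.
Proof.
  intros Hf HR He.
  set (s := (1 + rho) / 2). assert (Hs : rho < s < 1) by (unfold s; lra).
  destruct (taylor_coef_bound a f s Hf ltac:(lra)) as [K [HK0 HK]].
  set (q := rho / s).
  assert (Hq : 0 < q < 1).
  { unfold q. split; [apply Rdiv_lt_0_compat; lra|].
    apply Rmult_lt_reg_r with s; [lra|]. field_simplify; lra. }
  assert (Hv : is_series (fun k => K * q ^ k) (K * / (1 - q))).
  { apply rseries_scal, is_series_geom. rewrite Rabs_pos_eq; lra. }
  assert (Hlim := proj1 (is_series_Reals _ _) Hv).
  destruct (Hlim eps He) as [T0 HT0].
  exists (T0 + N)%nat. split; [lia|]. intros w Hw.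
  rewrite Cmod_minus_sym.
  rewrite taylor_on_disk_iff in Hf.
  eapply Rle_trans.
  - apply (cseries_Cmod_tail _ (fun k => K * q ^ k) _ (K * / (1 - q)));
      [apply Hf; unfold disk; lra| |exact Hv].
    intros k. rewrite Cmod_mult, Cmod_pow, Hw.
    replace rho with (s * q) by (unfold q; field; lra).
    rewrite Rpow_mult_distr, <- Rmult_assoc.
    apply Rmult_le_compat_r; [apply pow_le; lra|apply HK].
  - specialize (HT0 (T0 + N)%nat ltac:(lia)).
    unfold Rdist in HT0. rewrite Rabs_minus_sym in HT0.
    eapply Rle_trans; [apply Rle_abs|]. lra.
Qed.

(** On the circle of radius [1 - 1 / (2 (N + 1))] the function is [O(N ^ g)], whereas
    the [N]-th power of the radius stays above [1 / 2].  The harmonic sum in Landau's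
    inequality costs an extra power, for which any positive exponent will do:
    [(1 - g) / 2] keeps the total below [1]. *)
Lemma taylor_partial_sums_le a f c0 c1 g :
  taylor_on_disk a f -> 0 < g < 1 -> 0 <= c0 -> 0 <= c1 ->
  (forall z, disk z -> Cmod (f z) <= c0 + c1 * Rpower (1 - Cmod z) (- g)) ->
  exists K, 0 <= K /\
    forall N, Cmod (csum a N) <= K * Rpower (INR (S N)) ((1 + g) / 2).
Proof.
  intros Hf Hg Hc0 Hc1 Hgr.
  set (d := (1 - g) / 2). assert (Hd : 0 < d <= 1) by (unfold d; lra).
  set (K0 := c0 + 1 + c1 * Rpower 2 g).
  assert (HK0 : 0 <= K0).
  { unfold K0. pose proof (Rmult_le_pos _ _ Hc1 (Rlt_le _ _ (Rpower_pos 2 g))). lra. }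
  exists (2 * K0 / d). split.
  { apply Rmult_le_pos; [lra|]. apply Rlt_le, Rinv_0_lt_compat. lra. }
  intros N.
  assert (Hx : 1 <= INR (S N)) by (rewrite S_INR; pose proof (pos_INR N); lra).
  set (x := INR (S N)) in *.
  set (h := / (2 * x)).
  assert (Hh : 0 < h <= / 2).
  { unfold h. split; [apply Rinv_0_lt_compat; lra|]. apply Rinv_le_contravar; lra. }
  set (rho := 1 - h). assert (HR : 0 < rho < 1) by (unfold rho; lra).
  destruct (taylor_uniform_on_circle a f rho 1 N Hf HR Rlt_0_1) as [T [HT HTw]].
  assert (Hxg : 1 <= Rpower x g) by (apply Rpower_ge_1; lra).
  assert (HB : forall w, Cmod w = rho ->
      Cmod (csum (fun k => a k * w ^ k)%C T) <= K0 * Rpower x g).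
  { intros w Hw. specialize (HTw w Hw).
    pose proof (Cmod_le_add (csum (fun k => a k * w ^ k)%C T) (f w)) as H1.
    specialize (Hgr w ltac:(unfold disk; lra)). rewrite Hw in Hgr.
    replace (1 - rho) with (/ (2 * x)) in Hgr by (unfold rho, h; ring).
    rewrite Rpower_Ropp in Hgr.
    replace (/ Rpower (/ (2 * x)) g) with (Rpower 2 g * Rpower x g) in Hgr.
    2:{ rewrite <- Rpower_Ropp, Rpower_mult_distr by lra.
        unfold Rpower. rewrite ln_Rinv by lra. f_equal. ring. }
    unfold K0.
    assert (0 <= (c0 + 1) * (Rpower x g - 1)) by (apply Rmult_le_pos; lra).
    lra. }
  pose proof (landau_polynomial a rho (K0 * Rpower x g) T N HT ltac:(lra) HB) as HL.
  assert (HRN : / 2 <= rho ^ N).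
  { eapply Rle_trans; [|apply bernoulli_minus; lra].
    assert (INR N * h <= / 2); [|lra].
    apply Rle_trans with (x * h).
    - apply Rmult_le_compat_r; [lra|]. unfold x. rewrite S_INR. lra.
    - unfold h. apply Req_le. field. lra. }
  assert (HH : sum_f_R0 (fun i => landau_coef i ^ 2) N <= Rpower x d / d).
  { eapply Rle_trans; [|apply (harmonic_sum_le d N Hd)].
    apply sum_Rle. intros i _. apply landau_coef_sqr_le. }
  replace ((1 + g) / 2) with (g + d) by (unfold d; field).
  rewrite Rpower_plus.
  pose proof (Cmod_ge_0 (csum a N)) as HC.
  apply Rle_trans with (2 * (rho ^ N * Cmod (csum a N))); [nra|].
  replace (2 * K0 / d * (Rpower x g * Rpower x d))
    with (2 * (K0 * Rpower x g * (Rpower x d / d))) by (field; lra).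
  apply Rmult_le_compat_l; [lra|].
  eapply Rle_trans; [exact HL|].
  apply Rmult_le_compat_l; [|exact HH].
  apply Rmult_le_pos; [exact HK0|lra].
Qed.

(** * Convergence of the Hilbert coefficients *)

Lemma csum_by_parts (a d : nat -> C) N :
  csum (fun k => a k * d k)%C N
  = (csum (fun k => csum a k * (d k - d (S k))) N + csum a N * d (S N))%C.
Proof.
  induction N as [|N IH]; cbn [csum]; [ring|]. rewrite IH. cbn [csum]. ring.
Qed.

(** Summation by parts replaces [a_k / (n + k + 1)], which may fail to be absolutely
    summable, by [A_k / ((n + k + 1) * (n + k + 2))] with [A_k] the partial sums of
    [a]; these grow more slowly than [k], so that the new series converges absolutely
    and the boundary term vanishes in the limit. *)
Lemma hilbert_coef_converges a K g n :
  0 < g < 1 -> 0 <= K ->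
  (forall N, Cmod (csum a N) <= K * Rpower (INR (S N)) g) ->
  exists b : C, cseries (fun k => Cdiv (a k) (RtoC (INR (n + k + 1)))) b.
Proof.
  intros Hg HK Ha.
  set (d := fun k => (/ RtoC (INR (n + k + 1)))%C).
  assert (Hpos : forall k, 0 < INR (n + k + 1)) by (intros; apply lt_0_INR; lia).
  assert (HSk : forall k, INR (S k) <= INR (n + k + 1)) by (intros; apply le_INR; lia).
  assert (HS : forall k, 0 < INR (S k)) by (intros; apply lt_0_INR; lia).
  assert (Hdd : forall k, (d k - d (S k))%C =
     RtoC (/ (INR (n + k + 1) * INR (n + S k + 1)))).
  { intros k. unfold d. pose proof (Hpos k). pose proof (Hpos (S k)).
    rewrite <- !RtoC_inv by lra. rewrite <- RtoC_minus. f_equal.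
    replace (n + S k + 1)%nat with (S (n + k + 1)) in * by lia.
    rewrite S_INR in *. field. lra. }
  destruct (ex_cseries_le (fun k => csum a k * (d k - d (S k)))%C
    (fun k => K * Rpower (INR (S k)) (- (1 + (1 - g))))) as [b Hb].
  { intros k. rewrite Cmod_mult, Hdd, Cmod_R.
    rewrite Rabs_pos_eq by (apply Rlt_le, Rinv_0_lt_compat, Rmult_lt_0_compat; apply Hpos).
    replace (- (1 + (1 - g))) with (g - 1 - 1) by ring.
    rewrite !Rpower_pred by apply HS.
    replace (K * (Rpower (INR (S k)) g / INR (S k) / INR (S k)))
      with (K * Rpower (INR (S k)) g * / (INR (S k) * INR (S k)))
      by (pose proof (HS k); field; lra).
    apply Rmult_le_compat; [apply Cmod_ge_0| |apply Ha|].
    - apply Rlt_le, Rinv_0_lt_compat, Rmult_lt_0_compat; apply Hpos.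
    - pose proof (HS k). apply Rinv_le_contravar; [nra|].
      apply Rmult_le_compat; try lra; [apply HSk|apply le_INR; lia]. }
  { destruct (ex_series_Rpower (1 - g) ltac:(lra)) as [L HL].
    exists (K * L). now apply rseries_scal. }
  exists b. apply cseries_iff. intros eps He.
  destruct (proj1 (cseries_iff _ _) Hb (eps / 2) ltac:(lra)) as [N1 HN1].
  destruct (Rpower_opp_small (1 - g) (eps / 2 / (K + 1)) ltac:(lra)) as [N2 HN2].
  { apply Rdiv_lt_0_compat; lra. }
  exists (N1 + N2)%nat. intros N HN.
  specialize (HN1 N ltac:(lia)). specialize (HN2 N ltac:(lia)).
  replace (csum (fun k => Cdiv (a k) (RtoC (INR (n + k + 1)))) N)
    with (csum (fun k => csum a k * (d k - d (S k)))%C N + csum a N * d (S N))%C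
    by (symmetry; apply (csum_by_parts a d N)).
  set (X := csum (fun k => csum a k * (d k - d (S k)))%C N) in *.
  assert (HY : Cmod (csum a N * d (S N)) < eps / 2).
  { unfold d. rewrite Cmod_mult, <- RtoC_inv by (pose proof (Hpos (S N)); lra).
    rewrite Cmod_R, Rabs_pos_eq by (apply Rlt_le, Rinv_0_lt_compat, Hpos).
    apply Rle_lt_trans with (K * Rpower (INR (S N)) (- (1 - g))).
    - replace (- (1 - g)) with (g - 1) by ring. rewrite Rpower_pred by apply HS.
      unfold Rdiv. rewrite <- Rmult_assoc.
      apply Rmult_le_compat; [apply Cmod_ge_0| |apply Ha|].
      + apply Rlt_le, Rinv_0_lt_compat, Hpos.
      + apply Rinv_le_contravar; [apply HS|apply le_INR; lia].
    - apply Rmult_lt_compat_r with (r := K + 1) in HN2; [|lra].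
      replace (eps / 2 / (K + 1) * (K + 1)) with (eps / 2) in HN2 by (field; lra).
      pose proof (Rpower_pos (INR (S N)) (- (1 - g))). nra. }
  replace (X + csum a N * d (S N) - b)%C with ((X - b) + csum a N * d (S N))%C by ring.
  eapply Rle_lt_trans; [apply Cmod_triangle|]. lra.
Qed.

(** Abel's theorem on the radius: up to a vanishing boundary term, summation by parts
    exhibits [F x - l] as the mean of [csum u k - l] with the weights
    [(1 - x) * x ^ k], and as [x] tends to [1] these weights leave every finite set
    of indices. *)
Lemma abel_limit (u : nat -> C) (l : C) (F : R -> C) :
  cseries u l ->
  (forall x, 0 <= x < 1 -> cseries (fun k => u k * RtoC x ^ k)%C (F x)) ->
  forall eps, 0 < eps -> exists delta, 0 < delta /\
    forall x, 0 <= x < 1 -> 1 - delta < x -> Cmod (F x - l) <= eps.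
Proof.
  intros Hu HS eps He.
  destruct (proj1 (cseries_iff _ _) Hu (eps / 3) ltac:(lra)) as [N HN].
  set (D := fun k => Cmod (csum u k - l)).
  set (K := sum_f_R0 D N).
  assert (HD : forall k, 0 <= D k) by (intros; apply Cmod_ge_0).
  assert (HK : 0 <= K) by (apply cond_pos_sum; exact HD).
  exists (eps / 3 / (K + 1)). split; [apply Rdiv_lt_0_compat; lra|].
  intros x Hx Hdx.
  assert (HxK : (1 - x) * K <= eps / 3).
  { apply Rle_trans with ((1 - x) * (K + 1)); [nra|].
    apply Rlt_le. apply Rmult_lt_reg_r with (/ (K + 1)); [apply Rinv_0_lt_compat; lra|].
    replace ((1 - x) * (K + 1) * / (K + 1)) with (1 - x) by (field; lra).
    change (eps / 3 * / (K + 1)) with (eps / 3 / (K + 1)). lra. }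
  assert (Hpow : forall k, 0 <= x ^ k <= 1).
  { intros k. split; [apply pow_le; lra|]. rewrite <- (pow1 k). apply pow_incr. lra. }
  (* The remainder [1 - x ^ S n] makes the estimate stable under [n -> S n]: each
     index beyond [N] adds at most [eps / 3] times the weight [(1 - x) * x ^ n]. *)
  assert (Hsum : forall n, (1 - x) * sum_f_R0 (fun k => D k * x ^ k) n
    <= (1 - x) * K + eps / 3 * (1 - x ^ S n)).
  { intros n. destruct (Nat.le_gt_cases n N) as [Hn|Hn].
    - assert (sum_f_R0 (fun k => D k * x ^ k) n <= K).
      { apply Rle_trans with (sum_f_R0 D n).
        - apply sum_Rle. intros k _. specialize (HD k). specialize (Hpow k). nra.
        - unfold K. clear -HD Hn. induction Hn; [lra|].
          rewrite tech5. specialize (HD (S m)). lra. }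
      specialize (Hpow (S n)). nra.
    - replace n with (N + (n - N))%nat by lia. generalize (n - N)%nat as p. clear n Hn.
      intros p. induction p as [|p IH].
      + rewrite Nat.add_0_r.
        assert (sum_f_R0 (fun k => D k * x ^ k) N <= K).
        { apply sum_Rle. intros k _. specialize (HD k). specialize (Hpow k). nra. }
        specialize (Hpow (S N)). nra.
      + rewrite Nat.add_succ_r, tech5.
        pose proof (HN (S (N + p)) ltac:(lia)) as H. fold (D (S (N + p))) in H.
        pose proof (Hpow (S (N + p))).
        change (x ^ S (S (N + p))) with (x * x ^ S (N + p)).
        set (y := x ^ S (N + p)) in *.
        assert ((1 - x) * (D (S (N + p)) * y) <= (1 - x) * (eps / 3 * y)).
        { apply Rmult_le_compat_l; [lra|]. apply Rmult_le_compat_r; lra. }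
        lra. }
  assert (Hpart : forall n, (N <= n)%nat ->
    Cmod (csum (fun k => u k * RtoC x ^ k)%C n - l) <= eps).
  { intros n Hn. rewrite (csum_by_parts u (fun k => RtoC x ^ k)%C n).
    assert (El : l = (csum (fun k => l * (RtoC x ^ k - RtoC x ^ S k)) n
      + l * RtoC x ^ S n)%C).
    { rewrite csum_scal. clear. induction n as [|n IH]; cbn [csum].
      - simpl. ring.
      - transitivity (l * csum (fun k : nat => RtoC x ^ k - RtoC x ^ S k) n
          + l * RtoC x ^ S n)%C; [exact IH|]. simpl. ring. }
    rewrite El at 1. clear El.
    replace (csum (fun k => csum u k * (RtoC x ^ k - RtoC x ^ S k)) n
       + csum u n * RtoC x ^ S n
       - (csum (fun k => l * (RtoC x ^ k - RtoC x ^ S k)) n + l * RtoC x ^ S n))%C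
      with (csum (fun k => (csum u k - l) * (RtoC x ^ k - RtoC x ^ S k)) n
       + (csum u n - l) * RtoC x ^ S n)%C.
    2:{ transitivity ((csum (fun k => csum u k * (RtoC x ^ k - RtoC x ^ S k)) n
        - csum (fun k => l * (RtoC x ^ k - RtoC x ^ S k)) n)
        + (csum u n - l) * RtoC x ^ S n)%C; [|ring].
        f_equal. rewrite <- csum_minus. apply csum_ext. intros; ring. }
    eapply Rle_trans; [apply Cmod_triangle|].
    rewrite Cmod_mult, Cmod_pow, Cmod_R, (Rabs_pos_eq x) by lra.
    pose proof (HN n Hn) as HnD. specialize (Hsum n). specialize (Hpow (S n)).
    assert (Cmod (csum (fun k => (csum u k - l) * (RtoC x ^ k - RtoC x ^ S k))%C n)
      <= (1 - x) * sum_f_R0 (fun k => D k * x ^ k) n).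
    { eapply Rle_trans; [apply Cmod_csum|]. apply Req_le.
      rewrite scal_sum. apply sum_eq. intros k _.
      rewrite Cmod_mult. fold (D k).
      replace (RtoC x ^ k - RtoC x ^ S k)%C with (RtoC (x ^ k * (1 - x))).
      - rewrite Cmod_R, Rabs_pos_eq; [ring|].
        apply Rmult_le_pos; [apply pow_le|]; lra.
      - rewrite RtoC_mult, RtoC_minus, RtoC_pow. simpl. ring. }
    assert (Cmod (csum u n - l) * x ^ S n <= eps / 3 * 1).
    { apply Rmult_le_compat; try lra. apply Cmod_ge_0. }
    assert (0 <= eps / 3 * x ^ S n) by (apply Rmult_le_pos; lra).
    lra. }
  apply le_epsilon. intros e He'.
  destruct (proj1 (cseries_iff _ _) (HS x Hx) e He') as [N' HN'].
  specialize (HN' (N + N')%nat ltac:(lia)). specialize (Hpart (N + N')%nat ltac:(lia)).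
  rewrite Cmod_minus_sym in HN'.
  pose proof (Cmod_triangle_minus (F x) (csum (fun k => u k * RtoC x ^ k)%C (N + N')) l).
  lra.
Qed.

(** * Regularized Hilbert coefficients *)

Lemma taylor_exists (c : nat -> C) :
  (forall s, 0 < s < 1 -> exists K, forall k, Cmod (c k) * s ^ k <= K) ->
  exists F, taylor_on_disk c F.
Proof.
  intros Hc.
  assert (H : forall z, exists l : C, disk z -> cseries (fun k => c k * z ^ k)%C l).
  { intros z. destruct (Rlt_dec (Cmod z) 1) as [Hz|Hz]; [|exists (RtoC 0); intros Hd; now elim Hz].
    pose proof (Cmod_ge_0 z) as Hz0.
    set (s := (1 + Cmod z) / 2). assert (Hs : Cmod z < s < 1) by (unfold s; lra).
    destruct (Hc s ltac:(lra)) as [K HK].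
    set (q := Cmod z / s).
    assert (Hq : 0 <= q < 1).
    { unfold q. split; [apply Rmult_le_pos; [lra|apply Rlt_le, Rinv_0_lt_compat; lra]|].
      apply Rmult_lt_reg_r with s; [lra|]. field_simplify; lra. }
    destruct (ex_cseries_le (fun k => c k * z ^ k)%C (fun k => K * q ^ k)) as [l Hl].
    - intros k. rewrite Cmod_mult, Cmod_pow.
      replace (Cmod z) with (s * q) by (unfold q; field; lra).
      rewrite Rpow_mult_distr, <- Rmult_assoc.
      apply Rmult_le_compat_r; [apply pow_le; lra|apply HK].
    - exists (K * / (1 - q)). apply rseries_scal, is_series_geom. rewrite Rabs_pos_eq; lra.
    - now exists l. }
  exists (fun z => proj1_sig (constructive_indefinite_description _ (H z))).
  apply taylor_on_disk_iff. intros z Hz.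
  exact (proj2_sig (constructive_indefinite_description _ (H z)) Hz).
Qed.

Lemma taylor_at_0 a f : taylor_on_disk a f -> f (RtoC 0) = a O.
Proof.
  intros Hf. rewrite taylor_on_disk_iff in Hf.
  specialize (Hf (RtoC 0)). unfold disk in Hf. rewrite Cmod_0 in Hf.
  apply (cseries_unique _ _ _ (Hf Rlt_0_1)).
  apply cseries_iff. intros eps He. exists O. intros n _.
  replace (csum (fun k => a k * RtoC 0 ^ k)%C n) with (a O).
  - replace (a O - a O)%C with (RtoC 0) by ring. now rewrite Cmod_0.
  - induction n as [|n IH]; cbn [csum]; [simpl; ring|].
    rewrite <- IH. simpl. ring.
Qed.

(** The Taylor coefficients of [z ^ p * h z], when [u] are those of [h]. *)
Definition seq_delay (p : nat) (u : nat -> C) (m : nat) : C :=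
  if Nat.ltb m p then RtoC 0 else u (m - p)%nat.

Lemma csum_delay p u n : csum (seq_delay p u) (p + n) = csum u n.
Proof.
  induction n as [|n IH].
  - rewrite Nat.add_0_r. cbn [csum].
    destruct p as [|p]; [reflexivity|]. cbn [csum].
    rewrite csum_0.
    + unfold seq_delay. rewrite Nat.ltb_irrefl, Nat.sub_diag. ring.
    + intros k Hk. unfold seq_delay. now rewrite (proj2 (Nat.ltb_lt k (S p))) by lia.
  - rewrite Nat.add_succ_r. cbn [csum]. rewrite IH. f_equal.
    unfold seq_delay. rewrite (proj2 (Nat.ltb_ge (S (p + n)) p)) by lia.
    f_equal. lia.
Qed.

Lemma cseries_delay p (u : nat -> C) (l : C) :
  cseries u l -> cseries (seq_delay p u) l.
Proof.
  intros H. apply cseries_iff. intros eps He.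
  destruct (proj1 (cseries_iff _ _) H eps He) as [N HN].
  exists (p + N)%nat. intros n Hn.
  replace n with (p + (n - p))%nat by lia. rewrite csum_delay. apply HN. lia.
Qed.

Definition hilbert_term (a : nat -> C) (n k : nat) : C :=
  Cdiv (a k) (RtoC (INR (n + k + 1))).

(** The function [F] is the primitive of [z ^ n * f z] vanishing at [0]; its value at [1] is,
    formally, the [n]-th Hilbert coefficient of [f]. *)
Lemma hilbert_primitive_exists a f n :
  taylor_on_disk a f ->
  exists F, taylor_on_disk (seq_delay (S n) (hilbert_term a n)) F /\
    forall z, disk z -> C_derive F z = (z ^ n * f z)%C.
Proof.
  intros Hf.
  assert (HN : forall k, 1 <= INR (n + k + 1)).
  { intros k. change 1 with (INR 1). apply le_INR. lia. }
  destruct (taylor_exists (seq_delay (S n) (hilbert_term a n))) as [F HF].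
  { intros s Hs. destruct (taylor_coef_bound a f s Hf Hs) as [K [HK0 HK]].
    exists K. intros m. unfold seq_delay.
    destruct (Nat.ltb_spec m (S n)) as [Hm|Hm].
    - rewrite Cmod_0. lra.
    - set (k := (m - S n)%nat). unfold hilbert_term.
      specialize (HN k). specialize (HK k).
      rewrite Cmod_div by (intros E; apply RtoC_inj in E; lra).
      rewrite Cmod_R, Rabs_pos_eq by lra.
      eapply Rle_trans; [|exact HK].
      pose proof (Cmod_ge_0 (a k)).
      apply Rmult_le_compat.
      + apply Rmult_le_pos; [lra|]. apply Rlt_le, Rinv_0_lt_compat. lra.
      + apply pow_le. lra.
      + rewrite <- (Rmult_1_r (Cmod (a k))) at 2. apply Rmult_le_compat_l; [lra|].
        rewrite <- Rinv_1. apply Rinv_le_contravar; lra.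
      + replace m with (k + S n)%nat by (unfold k; lia). rewrite pow_add.
        rewrite <- (Rmult_1_r (s ^ k)) at 2.
        apply Rmult_le_compat_l; [apply pow_le; lra|].
        rewrite <- (pow1 (S n)). apply pow_incr. lra. }
  exists F. split; [exact HF|]. intros z Hz.
  apply taylor_C_derive in HF. rewrite taylor_on_disk_iff in HF, Hf.
  apply (cseries_unique _ _ _ (HF z Hz)).
  eapply cseries_ext; [|apply (cseries_delay n), cseries_scal, (Hf z Hz)].
  intros m. unfold seq_delay, deriv_coef.
  change (Nat.ltb (S m) (S n)) with (Nat.ltb m n). change (S m - S n)%nat with (m - n)%nat.
  destruct (Nat.ltb_spec m n) as [Hm|Hm]; [ring|].
  unfold hilbert_term. replace (n + (m - n) + 1)%nat with (S m) by lia.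
  replace (z ^ m)%C with (z ^ n * z ^ (m - n))%C.
  - field. intros E. apply RtoC_inj in E. now apply (not_0_INR (S m)).
  - rewrite <- Cpow_add_r. f_equal. lia.
Qed.

Definition tends_at_1 (phi : R -> C) (l : C) : Prop :=
  forall eps, 0 < eps -> exists delta, 0 < delta /\
    forall x, 0 <= x < 1 -> 1 - delta < x -> Cmod (phi x - l) <= eps.

Lemma tends_at_1_plus phi psi l m :
  tends_at_1 phi l -> tends_at_1 psi m ->
  tends_at_1 (fun x => phi x + psi x)%C (l + m)%C.
Proof.
  intros H1 H2 eps He.
  destruct (H1 (eps / 2) ltac:(lra)) as [d1 [Hd1 K1]].
  destruct (H2 (eps / 2) ltac:(lra)) as [d2 [Hd2 K2]].
  exists (Rmin d1 d2). split; [now apply Rmin_glb_lt|].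
  intros x Hx Hdx. pose proof (Rmin_l d1 d2). pose proof (Rmin_r d1 d2).
  replace (phi x + psi x - (l + m))%C with ((phi x - l) + (psi x - m))%C by ring.
  eapply Rle_trans; [apply Cmod_triangle|].
  specialize (K1 x Hx ltac:(lra)). specialize (K2 x Hx ltac:(lra)). lra.
Qed.

Lemma tends_at_1_scal c phi l :
  tends_at_1 phi l -> tends_at_1 (fun x => c * phi x)%C (c * l)%C.
Proof.
  intros H eps He. pose proof (Cmod_ge_0 c) as Hc.
  destruct (H (eps / (Cmod c + 1))) as [d [Hd K]]; [apply Rdiv_lt_0_compat; lra|].
  exists d. split; [exact Hd|]. intros x Hx Hdx. specialize (K x Hx Hdx).
  replace (c * phi x - c * l)%C with (c * (phi x - l))%C by ring.
  rewrite Cmod_mult. pose proof (Cmod_ge_0 (phi x - l)).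
  apply Rle_trans with ((Cmod c + 1) * (eps / (Cmod c + 1))); [nra|].
  apply Req_le. field. lra.
Qed.

Lemma tends_at_1_csum (phi : nat -> R -> C) (l : nat -> C) n :
  (forall k, tends_at_1 (phi k) (l k)) ->
  tends_at_1 (fun x => csum (fun k => phi k x) n) (csum l n).
Proof.
  intros H. induction n as [|n IH]; cbn [csum]; [apply H|].
  now apply tends_at_1_plus.
Qed.

Lemma tends_at_1_le phi l c B x0 :
  tends_at_1 phi l -> 0 <= x0 < 1 ->
  (forall x, x0 <= x < 1 -> Cmod (phi x - c) <= B) ->
  Cmod (l - c) <= B.
Proof.
  intros H Hx0 HB. apply le_epsilon. intros eps He.
  destruct (H eps He) as [d [Hd K]].
  set (x := Rmax x0 (1 - Rmin d 1 / 2)).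
  assert (Hx : x0 <= x < 1 /\ 1 - d < x).
  { pose proof (Rmin_glb_lt _ _ _ Hd Rlt_0_1). pose proof (Rmin_l d 1).
    pose proof (Rmax_l x0 (1 - Rmin d 1 / 2)). pose proof (Rmax_r x0 (1 - Rmin d 1 / 2)).
    fold x in H2, H3. repeat split; try lra.
    unfold x. apply Rmax_lub_lt; lra. }
  specialize (K x ltac:(lra) ltac:(lra)). specialize (HB x ltac:(lra)).
  rewrite Cmod_minus_sym in K.
  pose proof (Cmod_triangle_minus l (phi x) c). lra.
Qed.

Lemma Rpower_small_at_0 c eps :
  0 < c -> 0 < eps ->
  exists delta, 0 < delta /\ forall x, 0 < x < delta -> Rpower x c <= eps.
Proof.
  intros Hc He. exists (Rpower eps (/ c)). split; [apply Rpower_pos|].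
  intros x Hx. rewrite <- (Rpower_1 eps He), <- (Rinv_l c) by lra.
  rewrite <- Rpower_mult. apply Rle_Rpower_l; lra.
Qed.

Lemma one_minus_pow_le s n : 0 <= s <= 1 -> 1 - s ^ n <= INR n * (1 - s).
Proof.
  intros Hs. pose proof (bernoulli_minus (1 - s) n ltac:(lra)) as H.
  replace (1 - (1 - s)) with s in H by ring. lra.
Qed.

(** The integral of [t ^ n] over [[s, 1]]. *)
Definition hilbert_damping (n : nat) (s : R) : R := (1 - s ^ S n) / INR (S n).

Lemma hilbert_damping_bounds n s :
  0 <= s <= 1 -> 0 <= hilbert_damping n s <= 1 - s.
Proof.
  intros Hs. unfold hilbert_damping.
  assert (Hn : 0 < INR (S n)) by (apply lt_0_INR; lia).
  pose proof (one_minus_pow_le s (S n) Hs) as H.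
  assert (s ^ S n <= 1) by (rewrite <- (pow1 (S n)); apply pow_incr; lra).
  split.
  - apply Rmult_le_pos; [lra|]. apply Rlt_le, Rinv_0_lt_compat. exact Hn.
  - apply Rmult_le_reg_r with (INR (S n)); [exact Hn|].
    unfold Rdiv. rewrite Rmult_assoc, Rinv_l by lra. lra.
Qed.

(** The integral of [t ^ n * f t] over [[0, s]] tends to [b], but its derivative involves
    [f] rather than [f'].  Adding the term [hilbert_damping n s * f s] of an integration by
    parts repairs this; the addition is harmless in the limit, being
    [O((1 - s) ^ (2 - alpha))]. *)
Lemma hilbert_regularization a f alpha A n (b : C) :
  1 < alpha < 2 -> taylor_on_disk a f -> deriv_bound alpha A f ->
  cseries (hilbert_term a n) b ->
  exists phi : R -> C,
    phi 0 = (f (RtoC 0) * RtoC (/ INR (S n)))%C /\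
    tends_at_1 phi b /\
    forall s, 0 <= s < 1 ->
      is_Cderive phi s (RtoC (hilbert_damping n s) * C_derive f (RtoC s))%C.
Proof.
  intros Hal Hf HA Hb.
  pose proof (deriv_bound_nonneg _ _ _ HA) as HA0.
  destruct (hilbert_primitive_exists a f n Hf) as [F [HF HF']].
  exists (fun s => RtoC (hilbert_damping n s) * f (RtoC s) + F (RtoC s))%C.
  split; [|split].
  - rewrite (taylor_at_0 _ _ HF). unfold seq_delay, hilbert_damping.
    rewrite pow_i by lia. rewrite Rminus_0_r. unfold Rdiv. rewrite Rmult_1_l.
    change (Nat.ltb 0 (S n)) with true. cbv iota. ring.
  - replace b with (RtoC 0 + b)%C by ring. apply tends_at_1_plus.
    + intros eps He.
      set (g := alpha - 1).
      set (c0 := Cmod (f (RtoC 0))). assert (Hc0 : 0 <= c0) by apply Cmod_ge_0.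
      set (c1 := A / g).
      assert (Hc1 : 0 <= c1).
      { apply Rmult_le_pos; [exact HA0|]. apply Rlt_le, Rinv_0_lt_compat. unfold g. lra. }
      destruct (Rpower_small_at_0 (1 - g) (eps / 2 / (c1 + 1))) as [d [Hd Hsmall]];
        [unfold g; lra|apply Rdiv_lt_0_compat; lra|].
      exists (Rmin d (eps / 2 / (c0 + 1))). split.
      { apply Rmin_glb_lt; [exact Hd|apply Rdiv_lt_0_compat; lra]. }
      intros x Hx Hdx.
      assert (Hxd : 1 - x < d /\ 1 - x < eps / 2 / (c0 + 1)).
      { pose proof (Rmin_l d (eps / 2 / (c0 + 1))).
        pose proof (Rmin_r d (eps / 2 / (c0 + 1))). split; lra. }
      replace (RtoC (hilbert_damping n x) * f (RtoC x) - 0)%C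
        with (RtoC (hilbert_damping n x) * f (RtoC x))%C by ring.
      pose proof (hilbert_damping_bounds n x ltac:(lra)) as Hdamp.
      rewrite Cmod_mult, Cmod_R, Rabs_pos_eq by lra.
      pose proof (deriv_bound_growth a f alpha A Hf (proj1 Hal) HA (RtoC x)) as Hgr.
      unfold disk in Hgr. rewrite Cmod_R, Rabs_pos_eq in Hgr by lra.
      specialize (Hgr ltac:(lra)). fold g c1 in Hgr.
      pose proof (Cmod_le_add (f (RtoC x)) (f (RtoC 0))) as Htri. fold c0 in Htri.
      apply Rle_trans with ((1 - x) * (c0 + c1 * Rpower (1 - x) (- g))).
      { apply Rmult_le_compat; [lra|apply Cmod_ge_0|lra|lra]. }
      assert (E : (1 - x) * Rpower (1 - x) (- g) = Rpower (1 - x) (1 - g)).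
      { unfold Rminus at 4. rewrite Rpower_plus, Rpower_1 by lra. reflexivity. }
      specialize (Hsmall (1 - x) ltac:(lra)). rewrite <- E in Hsmall.
      assert (H1 : (1 - x) * c0 <= eps / 2).
      { apply Rle_trans with ((1 - x) * (c0 + 1)); [nra|].
        apply Rle_trans with (eps / 2 / (c0 + 1) * (c0 + 1)).
        - apply Rmult_le_compat_r; lra.
        - apply Req_le. field. lra. }
      assert (H2 : c1 * ((1 - x) * Rpower (1 - x) (- g)) <= eps / 2).
      { set (y := (1 - x) * Rpower (1 - x) (- g)) in *.
        assert (0 <= y) by (rewrite E; apply Rlt_le, Rpower_pos).
        apply Rle_trans with ((c1 + 1) * y); [lra|].
        apply Rle_trans with ((c1 + 1) * (eps / 2 / (c1 + 1))).
        - apply Rmult_le_compat_l; lra.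
        - apply Req_le. field. lra. }
      lra.
    + refine (abel_limit _ b (fun s => F (RtoC s)) (cseries_delay (S n) _ _ Hb) _).
      intros x Hx. rewrite taylor_on_disk_iff in HF. apply HF.
      unfold disk. rewrite Cmod_R, Rabs_pos_eq; lra.
  - intros s Hs.
    assert (Hds : disk (RtoC s)) by (unfold disk; rewrite Cmod_R, Rabs_pos_eq; lra).
    assert (Hreal : forall c h, taylor_on_disk c h ->
      is_Cderive (fun t => h (RtoC t)) s (C_derive h (RtoC s))).
    { intros c h Hh.
      pose proof (is_Cderive_ray h (RtoC 1) s (C_derive h (RtoC s))) as Hray.
      rewrite !Cmult_1_r, Cmult_1_l in Hray.
      destruct (Hray (taylor_is_derive c h _ Hh Hds)) as [H1 H2].
      split; (eapply is_derive_ext; [|eassumption]); intros t; cbv beta;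
        now rewrite Cmult_1_r. }
    assert (Hdd : is_derive (hilbert_damping n) s (- s ^ n)).
    { unfold hilbert_damping. pose proof (not_0_INR (S n) ltac:(lia)) as Hn.
      set (c := INR (S n)) in *. auto_derive; [trivial|].
      change (- (1 * (INR (S n) * s ^ n)) * / c = - s ^ n). fold c.
      field. exact Hn. }
    pose proof (is_Cderive_plus _ _ _ _ _
      (is_Cderive_mult_real _ _ _ _ _ Hdd (Hreal a f Hf)) (Hreal _ F HF)) as H.
    rewrite (HF' _ Hds) in H.
    replace (RtoC (- s ^ n) * f (RtoC s) + RtoC (hilbert_damping n s) * C_derive f (RtoC s)
       + RtoC s ^ n * f (RtoC s))%C
      with (RtoC (hilbert_damping n s) * C_derive f (RtoC s))%C in H.
    + exact H.
    + rewrite RtoC_opp, RtoC_pow. ring.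
Qed.

(** * Bounds for the Hilbert coefficients and their generating function *)

(** After division by [1 - s]: the mean of [1, s, ..., s ^ n] decreases with [n]. *)
Lemma power_mean_decreasing s n :
  0 <= s <= 1 -> INR n * (1 - s ^ S n) <= INR (S n) * (1 - s ^ n).
Proof.
  intros Hs.
  assert (H : INR n * (s ^ n * (1 - s)) <= 1 - s ^ n).
  { induction n as [|n IH]; [simpl; lra|].
    change (s ^ S n) with (s * s ^ n). rewrite S_INR.
    assert (0 <= s ^ n <= 1).
    { split; [apply pow_le; lra|]. rewrite <- (pow1 n). apply pow_incr. lra. }
    pose proof (Rmult_le_compat_l s _ _ (proj1 Hs) IH).
    assert (0 <= (1 - s) * (1 - s * s ^ n)) by (apply Rmult_le_pos; nra).
    lra. }
  rewrite S_INR. change (s ^ S n) with (s * s ^ n). lra.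
Qed.

(** In terms of integrals over [[s, 1]]: the sum of [(m + 1) * r ^ m * t ^ (m + 1)] is at
    most [1 / (1 - r * t) ^ 2], whose integral is the right-hand side.  Termwise, the
    left-hand side is dominated by [r ^ m * (1 - s ^ (m + 1))], a difference of
    geometric progressions. *)
Lemma hilbert_kernel_le r s N :
  0 <= r < 1 -> 0 <= s < 1 ->
  sum_f_R0 (fun m => INR (S m) * r ^ m * hilbert_damping (S m) s) N
  <= (1 - s) / ((1 - r) * (1 - s * r)).
Proof.
  intros Hr Hs.
  assert (Hrs : 0 <= s * r < 1) by nra.
  apply Rle_trans with (sum_f_R0 (fun m => r ^ m * (1 - s ^ S m)) N).
  - apply sum_Rle. intros m _.
    assert (Hm : 0 < INR (S (S m))) by (apply lt_0_INR; lia).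
    rewrite (Rmult_comm (INR (S m))), Rmult_assoc.
    apply Rmult_le_compat_l; [apply pow_le; lra|].
    unfold hilbert_damping. apply Rmult_le_reg_r with (INR (S (S m))); [exact Hm|].
    replace (INR (S m) * ((1 - s ^ S (S m)) / INR (S (S m))) * INR (S (S m)))
      with (INR (S m) * (1 - s ^ S (S m))) by (field; lra).
    rewrite (Rmult_comm _ (INR (S (S m)))).
    apply power_mean_decreasing. lra.
  - assert (E : sum_f_R0 (fun m => r ^ m * (1 - s ^ S m)) N
      = (1 - r ^ S N) / (1 - r) - s * (1 - (s * r) ^ S N) / (1 - s * r)).
    { induction N as [|N IH].
      - simpl. field. lra.
      - rewrite tech5, IH. rewrite !Rpow_mult_distr. simpl. field. lra. }
    rewrite E. apply Rminus_le. clear E.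
    replace ((1 - r ^ S N) / (1 - r) - s * (1 - (s * r) ^ S N) / (1 - s * r)
        - (1 - s) / ((1 - r) * (1 - s * r)))
      with (s * (s * r) ^ S N / (1 - s * r) - r ^ S N / (1 - r)) by (field; lra).
    assert (H : s * (s * r) ^ S N / (1 - s * r) <= 1 * r ^ S N / (1 - r)); [|lra].
    assert (0 <= (s * r) ^ S N <= r ^ S N).
    { split; [apply pow_le; lra|]. apply pow_incr. nra. }
    apply Rmult_le_compat.
    + apply Rmult_le_pos; lra.
    + apply Rlt_le, Rinv_0_lt_compat. lra.
    + apply Rmult_le_compat; lra.
    + apply Rinv_le_contravar; nra.
Qed.

(** The last factor is the derivative of [ln ((1 + s) / (1 - s * r))].  Its increment
    over [[0, r]] is [- ln (1 - r)], the logarithm which the target weight absorbs. *)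
Lemma weight_le_inner alpha r s :
  1 < alpha -> 0 <= s <= r -> r < 1 ->
  Rpower (1 - s ^ 2) (- alpha) * ((1 - s) / ((1 - r) * (1 - s * r)))
  <= Rpower (1 - r ^ 2) (- alpha) * ((1 + r) / ((1 + s) * (1 - s * r))).
Proof.
  intros Ha Hs Hr.
  assert (Hsr : 0 <= s * r < 1) by nra.
  assert (Hu : 0 < 1 - r ^ 2 <= 1 - s ^ 2) by nra.
  assert (Hp : forall u, 0 < u -> Rpower u (- alpha) * u = Rpower u (- (alpha - 1))).
  { intros u Hu0. replace (- (alpha - 1)) with (- alpha + 1) by ring.
    now rewrite Rpower_plus, Rpower_1. }
  assert (E : Rpower (1 - s ^ 2) (- alpha) * (1 - s ^ 2)
    <= Rpower (1 - r ^ 2) (- alpha) * (1 - r ^ 2)).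
  { rewrite !Hp by lra. apply Rpower_opp_le; lra. }
  set (U := Rpower (1 - s ^ 2) (- alpha)) in *.
  set (V := Rpower (1 - r ^ 2) (- alpha)) in *.
  replace (U * ((1 - s) / ((1 - r) * (1 - s * r))))
    with (U * (1 - s ^ 2) * / ((1 + s) * (1 - r) * (1 - s * r))) by (field; lra).
  replace (V * ((1 + r) / ((1 + s) * (1 - s * r))))
    with (V * (1 - r ^ 2) * / ((1 + s) * (1 - r) * (1 - s * r))) by (field; lra).
  apply Rmult_le_compat_r; [|exact E].
  apply Rlt_le, Rinv_0_lt_compat. repeat apply Rmult_lt_0_compat; lra.
Qed.

Lemma Rpower_factor s c :
  0 <= s < 1 -> Rpower (1 - s ^ 2) c = Rpower (1 + s) c * Rpower (1 - s) c.
Proof.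
  intros Hs. rewrite Rpower_mult_distr by lra. f_equal. ring.
Qed.

(** For [s >= r] the bound [1 - s * r >= 1 - r] suffices: the remaining singularity
    [(1 - s) ^ (1 - alpha)] is integrable because [alpha < 2]. *)
Lemma weight_le_outer alpha r s :
  1 < alpha -> 0 <= r <= s -> s < 1 ->
  Rpower (1 - s ^ 2) (- alpha) * ((1 - s) / ((1 - r) * (1 - s * r)))
  <= Rpower (1 + r) (- alpha) / (1 - r) ^ 2 * Rpower (1 - s) (1 - alpha).
Proof.
  intros Ha Hr Hs.
  assert (Hsr : 0 <= s * r < 1) by nra.
  rewrite Rpower_factor by lra.
  replace (1 - alpha) with (- alpha + 1) by ring.
  rewrite Rpower_plus, Rpower_1 by lra.
  assert (H1 : Rpower (1 + s) (- alpha) <= Rpower (1 + r) (- alpha))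
    by (apply Rpower_opp_le; lra).
  pose proof (Rpower_pos (1 + s) (- alpha)).
  pose proof (Rpower_pos (1 - s) (- alpha)).
  set (U := Rpower (1 + s) (- alpha)) in *.
  set (V := Rpower (1 + r) (- alpha)) in *.
  set (W := Rpower (1 - s) (- alpha)) in *.
  replace (U * W * ((1 - s) / ((1 - r) * (1 - s * r))))
    with ((W * (1 - s)) * (U * / ((1 - r) * (1 - s * r)))) by (field; lra).
  replace (V / (1 - r) ^ 2 * (W * (1 - s)))
    with ((W * (1 - s)) * (V * / ((1 - r) * (1 - r)))) by (field; lra).
  apply Rmult_le_compat_l; [apply Rmult_le_pos; lra|].
  apply Rmult_le_compat; [lra| |exact H1|].
  - apply Rlt_le, Rinv_0_lt_compat, Rmult_lt_0_compat; lra.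
  - apply Rinv_le_contravar; [apply Rmult_lt_0_compat; lra|].
    apply Rmult_le_compat_l; [lra|]. nra.
Qed.

(** The derivative of the regularization is at most [A * (1 - s) ^ (1 - alpha)], whose
    integral over [[0, 1]] is [A / (2 - alpha)]. *)
Lemma hilbert_coef_le (alpha A : R) (a b : nat -> C) (f : C -> C) n :
  1 < alpha < 2 -> taylor_on_disk a f -> deriv_bound alpha A f ->
  (forall n, cseries (hilbert_term a n) (b n)) ->
  Cmod (b n - f (RtoC 0) * RtoC (/ INR (S n))) <= A / (2 - alpha).
Proof.
  intros Halpha Hf HA Hb.
  pose proof (deriv_bound_nonneg _ _ _ HA) as HA0.
  destruct (hilbert_regularization a f alpha A n (b n) Halpha Hf HA (Hb n))
    as (phi & Hphi0 & Hphi1 & Hphi').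
  apply (tends_at_1_le phi _ _ _ 0 Hphi1); [lra|]. intros x Hx.
  rewrite <- Hphi0.
  set (c := A / (2 - alpha)).
  assert (Hc : 0 <= c).
  { apply Rmult_le_pos; [exact HA0|]. apply Rlt_le, Rinv_0_lt_compat. lra. }
  eapply Rle_trans.
  - apply (Cmean_value_le phi (fun s => RtoC (hilbert_damping n s) * C_derive f (RtoC s))%C
      (fun s => - c * Rpower (1 + -1 * s) (2 - alpha))
      (fun s => - c * (-1 * (2 - alpha) * Rpower (1 + -1 * s) (2 - alpha - 1))) 0 x).
    + lra.
    + intros s Hs. apply Hphi'. lra.
    + intros s Hs. apply is_derive_scal, is_derive_Rpower_affine. lra.
    + intros s Hs.
      pose proof (hilbert_damping_bounds n s ltac:(lra)) as Hd.
      rewrite Cmod_mult, Cmod_R, Rabs_pos_eq by lra.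
      pose proof (HA (RtoC s)) as H. unfold disk in H.
      rewrite Cmod_R, Rabs_pos_eq in H by lra. specialize (H ltac:(lra)).
      replace (- c * (-1 * (2 - alpha) * Rpower (1 + -1 * s) (2 - alpha - 1)))
        with ((1 - s) * (A * Rpower (1 - s) (- alpha))).
      * apply Rmult_le_compat; [lra|apply Cmod_ge_0|lra|].
        eapply Rle_trans; [exact H|]. apply Rmult_le_compat_l; [exact HA0|].
        apply Rpower_opp_le; nra.
      * replace (1 + -1 * s) with (1 - s) by ring.
        replace (2 - alpha - 1) with (- alpha + 1) by ring.
        rewrite Rpower_plus, Rpower_1 by lra. unfold c. field. lra.
  - replace (1 + -1 * 0) with 1 by ring.
    replace (Rpower 1 (2 - alpha)) with 1
      by (unfold Rpower; rewrite ln_1, Rmult_0_r, exp_0; reflexivity).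
    pose proof (Rpower_pos (1 + -1 * x) (2 - alpha)). nra.
Qed.

(** The bound does not depend on the length [N] of the partial sum.  A finite sum of
    regularizations passes to the limit at [1] for free, and only afterwards does [N]
    go to infinity, so limit and summation never have to be exchanged. *)
Lemma hilbert_deriv_partial_le (alpha A : R) (a b : nat -> C) (f : C -> C) z N :
  1 < alpha < 2 -> taylor_on_disk a f -> deriv_bound alpha A f ->
  (forall n, cseries (hilbert_term a n) (b n)) ->
  disk z ->
  Cmod (csum (fun m => deriv_coef b m * z ^ m)%C N
    - csum (fun m => (RtoC (INR (S m)) * z ^ m) * (f (RtoC 0) * RtoC (/ INR (S (S m)))))%C N)
  <= A * Rpower (1 - Cmod z ^ 2) (- alpha) * (- ln (1 - Cmod z) + / (2 - alpha)).
Proof.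
  intros Halpha Hf HA Hb.
  intros Hz. unfold disk in Hz. pose proof (Cmod_ge_0 z) as Hz0.
  set (r := Cmod z) in *.
  pose proof (deriv_bound_nonneg _ _ _ HA) as HA0.
  set (lam := fun m => (RtoC (INR (S m)) * z ^ m)%C).
  destruct (choice (fun n (phi : R -> C) =>
    phi 0 = (f (RtoC 0) * RtoC (/ INR (S n)))%C /\
    tends_at_1 phi (b n) /\
    forall s, 0 <= s < 1 ->
      is_Cderive phi s (RtoC (hilbert_damping n s) * C_derive f (RtoC s))%C))
    as [phi Hphi].
  { intros n. exact (hilbert_regularization a f alpha A n (b n) Halpha Hf HA (Hb n)). }
  set (X := fun s => csum (fun m => lam m * phi (S m) s)%C N).
  set (dX := fun s => csum (fun m =>
    lam m * (RtoC (hilbert_damping (S m) s) * C_derive f (RtoC s)))%C N).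
  assert (HX0 : csum (fun m => (RtoC (INR (S m)) * z ^ m) * (f (RtoC 0) * RtoC (/ INR (S (S m)))))%C N = X 0).
  { apply csum_ext. intros m _. now rewrite (proj1 (Hphi (S m))). }
  assert (HX1 : tends_at_1 X (csum (fun m => deriv_coef b m * z ^ m)%C N)).
  { replace (csum (fun m => deriv_coef b m * z ^ m)%C N)
      with (csum (fun m => lam m * b (S m))%C N).
    - apply (tends_at_1_csum (fun m s => lam m * phi (S m) s)%C).
      intros m. apply tends_at_1_scal, Hphi.
    - apply csum_ext. intros m _. unfold lam, deriv_coef. ring. }
  assert (HdX : forall s, 0 <= s < 1 -> is_Cderive X s (dX s)).
  { intros s Hs.
    apply (is_Cderive_csum (fun m s => lam m * phi (S m) s)%C).
    intros m. apply is_Cderive_scal. now apply Hphi. }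
  assert (HdXle : forall s, 0 <= s < 1 -> Cmod (dX s) <=
    A * (Rpower (1 - s ^ 2) (- alpha) * ((1 - s) / ((1 - r) * (1 - s * r))))).
  { intros s Hs.
    pose proof (HA (RtoC s)) as H. unfold disk in H.
    rewrite Cmod_R, Rabs_pos_eq in H by lra. specialize (H ltac:(lra)).
    eapply Rle_trans; [apply Cmod_csum|].
    rewrite (sum_eq _ (fun m => INR (S m) * r ^ m * hilbert_damping (S m) s
        * Cmod (C_derive f (RtoC s)))).
    - rewrite <- scal_sum, <- Rmult_assoc.
      apply Rmult_le_compat; [apply Cmod_ge_0| |exact H|].
      + apply cond_pos_sum. intros m.
        apply Rmult_le_pos; [apply Rmult_le_pos; [apply pos_INR|apply pow_le; lra]|].
        apply hilbert_damping_bounds. lra.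
      + apply hilbert_kernel_le; lra.
    - intros m _. unfold lam.
      rewrite !Cmod_mult, Cmod_pow, !Cmod_R. fold r.
      rewrite (Rabs_pos_eq (INR (S m))) by apply pos_INR.
      rewrite (Rabs_pos_eq (hilbert_damping (S m) s))
        by (apply hilbert_damping_bounds; lra).
      ring. }
  rewrite HX0.
  set (w := Rpower (1 - r ^ 2) (- alpha)).
  assert (Hinner : Cmod (X r - X 0) <= A * w * - ln (1 - r)).
  { eapply Rle_trans.
    - apply (Cmean_value_le X dX (fun s => A * w * (ln (1 + s) - ln (1 - s * r)))
        (fun s => A * w * ((1 + r) / ((1 + s) * (1 - s * r)))) 0 r).
      + lra.
      + intros s Hs. apply HdX. lra.
      + intros s Hs. assert (0 <= s * r < 1) by nra.
        auto_derive; [lra|]. field. lra.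
      + intros s Hs. eapply Rle_trans; [apply HdXle; lra|].
        rewrite Rmult_assoc. apply Rmult_le_compat_l; [exact HA0|].
        apply weight_le_inner; lra.
    - apply Req_le. replace (1 - r * r) with ((1 + r) * (1 - r)) by ring.
      rewrite ln_mult by lra. rewrite Rplus_0_r, Rmult_0_l, Rminus_0_r, ln_1. ring. }
  set (c := Rpower (1 + r) (- alpha) / (1 - r) ^ 2).
  assert (Hc : 0 <= c).
  { apply Rlt_le, Rdiv_lt_0_compat; [apply Rpower_pos|apply pow_lt; lra]. }
  assert (Houter : forall x, r <= x < 1 -> Cmod (X x - X r) <= A * w * / (2 - alpha)).
  { intros x Hx.
    assert (Hk : 0 <= A * c / (2 - alpha)).
    { apply Rmult_le_pos; [now apply Rmult_le_pos|]. apply Rlt_le, Rinv_0_lt_compat. lra. }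
    eapply Rle_trans.
    - apply (Cmean_value_le X dX
        (fun s => - (A * c / (2 - alpha)) * Rpower (1 + -1 * s) (2 - alpha))
        (fun s => - (A * c / (2 - alpha)) *
           (-1 * (2 - alpha) * Rpower (1 + -1 * s) (2 - alpha - 1))) r x).
      + lra.
      + intros s Hs. apply HdX. lra.
      + intros s Hs. apply is_derive_scal, is_derive_Rpower_affine. lra.
      + intros s Hs. eapply Rle_trans; [apply HdXle; lra|].
        replace (- (A * c / (2 - alpha)) *
           (-1 * (2 - alpha) * Rpower (1 + -1 * s) (2 - alpha - 1)))
          with (A * (c * Rpower (1 - s) (1 - alpha))).
        * apply Rmult_le_compat_l; [exact HA0|]. apply weight_le_outer; lra.
        * replace (1 + -1 * s) with (1 - s) by ring.
          replace (2 - alpha - 1) with (1 - alpha) by ring. field. lra.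
    - apply Rle_trans with (A * c / (2 - alpha) * Rpower (1 + -1 * r) (2 - alpha)).
      + pose proof (Rmult_le_pos _ _ Hk (Rlt_le _ _ (Rpower_pos (1 + -1 * x) (2 - alpha)))).
        lra.
      + apply Req_le. replace (1 + -1 * r) with (1 - r) by ring.
        unfold c, w. rewrite Rpower_factor by lra.
        replace (2 - alpha) with (- alpha + INR 2) at 2 by (simpl; ring).
        rewrite Rpower_plus, Rpower_pow by lra. field. lra. }
  apply (tends_at_1_le X _ _ _ r HX1); [lra|]. intros x Hx.
  specialize (Houter x Hx).
  pose proof (Cmod_triangle_minus (X x) (X r) (X 0)).
  rewrite Rmult_plus_distr_l. lra.
Qed.

Lemma hilbert_constant_part_le (f : C -> C) z N :
  disk z ->
  Cmod (csum (fun m => (RtoC (INR (S m)) * z ^ m) * (f (RtoC 0) * RtoC (/ INR (S (S m)))))%C N)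
  <= Cmod (f (RtoC 0)) / (1 - Cmod z).
Proof.
  intros Hz. unfold disk in Hz. pose proof (Cmod_ge_0 z) as Hz0.
  set (r := Cmod z) in *.
  eapply Rle_trans; [apply Cmod_csum|].
  apply Rle_trans with (sum_f_R0 (fun m => r ^ m * Cmod (f (RtoC 0))) N).
  - apply sum_Rle. intros m _.
    rewrite !Cmod_mult, Cmod_pow, !Cmod_R. fold r.
    rewrite (Rabs_pos_eq (INR (S m))) by apply pos_INR.
    assert (Hm : 0 < INR (S (S m))) by (apply lt_0_INR; lia).
    rewrite Rabs_pos_eq by (apply Rlt_le, Rinv_0_lt_compat, Hm).
    assert (0 <= INR (S m) * / INR (S (S m)) <= 1).
    { split; [apply Rmult_le_pos; [apply pos_INR|apply Rlt_le, Rinv_0_lt_compat, Hm]|].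
      apply Rmult_le_reg_r with (INR (S (S m))); [exact Hm|].
      rewrite Rmult_assoc, Rinv_l by lra. rewrite (S_INR (S m)). lra. }
    assert (0 <= r ^ m * Cmod (f (RtoC 0)))
      by (apply Rmult_le_pos; [apply pow_le; lra|apply Cmod_ge_0]).
    replace (INR (S m) * r ^ m * (Cmod (f (RtoC 0)) * / INR (S (S m))))
      with (INR (S m) * / INR (S (S m)) * (r ^ m * Cmod (f (RtoC 0)))) by ring.
    nra.
  - rewrite <- scal_sum. apply Rmult_le_compat_l; [apply Cmod_ge_0|].
    rewrite tech3 by lra. rewrite <- (Rmult_1_l (/ (1 - r))). unfold Rdiv.
    apply Rmult_le_compat_r; [apply Rlt_le, Rinv_0_lt_compat; lra|].
    pose proof (pow_le r (S N) Hz0). lra.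
Qed.

Lemma hilbert_image_deriv_le (alpha A : R) (a b : nat -> C) (f : C -> C) g z :
  1 < alpha < 2 -> taylor_on_disk a f -> deriv_bound alpha A f ->
  (forall n, cseries (hilbert_term a n) (b n)) ->
  taylor_on_disk b g -> disk z ->
  Cmod (C_derive g z) <= Cmod (f (RtoC 0)) / (1 - Cmod z)
    + A * Rpower (1 - Cmod z ^ 2) (- alpha) * (- ln (1 - Cmod z) + / (2 - alpha)).
Proof.
  intros Halpha Hf HA Hb.
  intros Hg Hz. pose proof (taylor_C_derive b g Hg) as Hg'.
  rewrite taylor_on_disk_iff in Hg'.
  apply (cseries_Cmod_partial_le _ _ _ (Hg' z Hz)). intros N.
  pose proof (hilbert_deriv_partial_le alpha A a b f z N Halpha Hf HA Hb Hz) as H1.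
  pose proof (hilbert_constant_part_le f z N Hz) as H2.
  eapply Rle_trans; [apply Cmod_le_add|]. apply Rplus_le_compat; [exact H2|exact H1].
Qed.

(** With [l = - ln (1 - |z|)] and [c = 1 / (2 - alpha) >= 1], the logarithmic weight
    gives [(l + c) / (1 + 2 * l) <= c]; the contribution of [f (0)] is bounded through
    [(1 - r ^ 2) ^ alpha <= 2 * (1 - r)]. *)
Lemma hilbert_image_weighted_le (alpha A : R) (a b : nat -> C) (f : C -> C) g z :
  1 < alpha < 2 -> taylor_on_disk a f -> deriv_bound alpha A f ->
  (forall n, cseries (hilbert_term a n) (b n)) ->
  taylor_on_disk b g -> disk z ->
  / ln (exp 1 / (1 - Cmod z) ^ 2) * Rpower (1 - Cmod z ^ 2) alpha * Cmod (C_derive g z)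
  <= 2 * Cmod (f (RtoC 0)) + A / (2 - alpha).
Proof.
  intros Halpha Hf HA Hb.
  intros Hg Hz. pose proof (hilbert_image_deriv_le alpha A a b f g z Halpha Hf HA Hb Hg Hz) as H.
  unfold disk in Hz. pose proof (Cmod_ge_0 z) as Hz0. set (r := Cmod z) in *.
  pose proof (deriv_bound_nonneg _ _ _ HA) as HA0.
  set (l := - ln (1 - r)) in *.
  assert (Hl : 0 <= l).
  { unfold l. assert (ln (1 - r) <= ln 1) by (apply ln_le; lra). rewrite ln_1 in H0. lra. }
  assert (HL : ln (exp 1 / (1 - r) ^ 2) = 1 + 2 * l).
  { unfold Rdiv. rewrite ln_mult; [|apply exp_pos|apply Rinv_0_lt_compat, pow_lt; lra].
    rewrite ln_exp, ln_Rinv by (apply pow_lt; lra).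
    replace ((1 - r) ^ 2) with ((1 - r) * (1 - r)) by ring.
    rewrite ln_mult by lra. unfold l. ring. }
  rewrite HL.
  assert (Hr2 : 0 < 1 - r ^ 2 <= 1) by nra.
  set (W := Rpower (1 - r ^ 2) alpha).
  assert (HW : 0 < W) by apply Rpower_pos.
  assert (HWr : W <= 2 * (1 - r)).
  { unfold W. replace alpha with (1 + (alpha - 1)) by ring.
    rewrite Rpower_plus, Rpower_1 by lra.
    assert (Rpower (1 - r ^ 2) (alpha - 1) <= 1).
    { replace 1 with (Rpower 1 (alpha - 1)) at 3
        by (unfold Rpower; rewrite ln_1, Rmult_0_r, exp_0; reflexivity).
      apply Rle_Rpower_l; lra. }
    apply Rle_trans with ((1 - r ^ 2) * 1); [apply Rmult_le_compat_l; lra|nra]. }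
  assert (HWw : W * Rpower (1 - r ^ 2) (- alpha) = 1).
  { unfold W. rewrite <- Rpower_plus, Rplus_opp_r, Rpower_O by lra. reflexivity. }
  set (c0 := Cmod (f (RtoC 0))) in *. assert (Hc0 : 0 <= c0) by apply Cmod_ge_0.
  set (w := Rpower (1 - r ^ 2) (- alpha)) in *.
  apply Rle_trans with (/ (1 + 2 * l) * W * (c0 / (1 - r) + A * w * (l + / (2 - alpha)))).
  { apply Rmult_le_compat_l; [|exact H].
    apply Rmult_le_pos; [|lra]. apply Rlt_le, Rinv_0_lt_compat. lra. }
  replace (/ (1 + 2 * l) * W * (c0 / (1 - r) + A * w * (l + / (2 - alpha))))
    with (c0 * ((W / (1 - r)) * / (1 + 2 * l))
      + A * (W * w) * ((l + / (2 - alpha)) / (1 + 2 * l))) by (field; lra).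
  rewrite HWw, Rmult_1_r.
  assert (Hq : / (1 + 2 * l) <= 1).
  { rewrite <- Rinv_1 at 2. apply Rinv_le_contravar; lra. }
  assert (Hq0 : 0 < / (1 + 2 * l)) by (apply Rinv_0_lt_compat; lra).
  apply Rplus_le_compat.
  - rewrite (Rmult_comm 2 c0). apply Rmult_le_compat_l; [exact Hc0|].
    assert (W / (1 - r) <= 2).
    { apply Rmult_le_reg_r with (1 - r); [lra|].
      unfold Rdiv. rewrite Rmult_assoc, Rinv_l by lra. lra. }
    assert (0 <= W / (1 - r)) by (apply Rlt_le, Rdiv_lt_0_compat; lra).
    nra.
  - apply Rmult_le_compat_l; [exact HA0|].
    assert (Hk : 1 <= / (2 - alpha)) by (rewrite <- Rinv_1; apply Rinv_le_contravar; lra).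
    apply Rmult_le_reg_r with (1 + 2 * l); [lra|].
    unfold Rdiv at 1. rewrite Rmult_assoc, Rinv_l by lra. nra.
Qed.

Lemma hilbert_image_at_0_le (alpha A : R) (a b : nat -> C) (f : C -> C) g :
  1 < alpha < 2 -> taylor_on_disk a f -> deriv_bound alpha A f ->
  (forall n, cseries (hilbert_term a n) (b n)) ->
  taylor_on_disk b g -> Cmod (g (RtoC 0)) <= Cmod (f (RtoC 0)) + A / (2 - alpha).
Proof.
  intros Halpha Hf HA Hb.
  intros Hg. rewrite (taylor_at_0 b g Hg).
  pose proof (hilbert_coef_le alpha A a b f 0 Halpha Hf HA Hb) as H. simpl INR in H. rewrite Rinv_1 in H.
  replace (f (RtoC 0) * 1)%C with (f (RtoC 0)) in H by ring.
  pose proof (Cmod_le_add (b O) (f (RtoC 0))). lra.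
Qed.

Lemma hilbert_image_exists (alpha A : R) (a b : nat -> C) (f : C -> C) :
  1 < alpha < 2 -> taylor_on_disk a f -> deriv_bound alpha A f ->
  (forall n, cseries (hilbert_term a n) (b n)) ->
  exists g, taylor_on_disk b g.
Proof.
  intros Halpha Hf HA Hb.
  apply taylor_exists. intros s Hs.
  pose proof (deriv_bound_nonneg _ _ _ HA) as HA0.
  exists (Cmod (f (RtoC 0)) + A / (2 - alpha)). intros n.
  pose proof (hilbert_coef_le alpha A a b f n Halpha Hf HA Hb) as H.
  pose proof (Cmod_le_add (b n) (f (RtoC 0) * RtoC (/ INR (S n)))) as H1.
  rewrite Cmod_mult, Cmod_R in H1.
  assert (Hn : 1 <= INR (S n)) by (rewrite S_INR; pose proof (pos_INR n); lra).
  assert (Hi : 0 < / INR (S n) <= 1).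
  { split; [apply Rinv_0_lt_compat; lra|]. rewrite <- Rinv_1. apply Rinv_le_contravar; lra. }
  rewrite Rabs_pos_eq in H1 by lra.
  pose proof (Cmod_ge_0 (f (RtoC 0))). pose proof (Cmod_ge_0 (b n)).
  assert (0 <= s ^ n <= 1).
  { split; [apply pow_le; lra|]. rewrite <- (pow1 n). apply pow_incr. lra. }
  nra.
Qed.

Lemma hilbert_coefs_exist a f alpha A :
  1 < alpha < 2 -> taylor_on_disk a f -> deriv_bound alpha A f ->
  exists b : nat -> C, forall n, cseries (hilbert_term a n) (b n).
Proof.
  intros Hal Hf HA. pose proof (deriv_bound_nonneg _ _ _ HA) as HA0.
  destruct (taylor_partial_sums_le a f (Cmod (f (RtoC 0))) (A / (alpha - 1)) (alpha - 1))
    as (K & HK0 & HK); [exact Hf|lra|apply Cmod_ge_0| | |].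
  - apply Rmult_le_pos; [exact HA0|]. apply Rlt_le, Rinv_0_lt_compat. lra.
  - intros z Hz. pose proof (deriv_bound_growth a f alpha A Hf (proj1 Hal) HA z Hz).
    pose proof (Cmod_le_add (f z) (f (RtoC 0))). lra.
  - apply (choice (fun n b => cseries (hilbert_term a n) b)).
    intros n. apply (hilbert_coef_converges a K ((1 + (alpha - 1)) / 2) n); [lra|exact HK0|exact HK].
Qed.

(** * The norms *)

Lemma weighted_bloch_norm_finite w f :
  Rbar_lt (weighted_bloch_norm w f) p_infty ->
  exists A : R,
    weighted_bloch_norm w f = Finite (Cmod (f (RtoC 0)) + A) /\
    forall z, disk z -> w (Cmod z) * Cmod (C_derive f z) <= A.
Proof.
  intros H. unfold weighted_bloch_norm in *.
  set (E := fun x : R => exists z : C, disk z /\ x = w (Cmod z) * Cmod (C_derive f z)) in *.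
  destruct (Lub_Rbar_correct E) as [Hub _].
  assert (H0 : E (w (Cmod (RtoC 0)) * Cmod (C_derive f (RtoC 0)))).
  { exists (RtoC 0). split; [unfold disk; rewrite Cmod_0; lra|reflexivity]. }
  destruct (Lub_Rbar E) as [A| |].
  - exists A. split; [reflexivity|]. intros z Hz.
    apply (Hub (w (Cmod z) * Cmod (C_derive f z))). now exists z.
  - elim H.
  - elim (Hub _ H0).
Qed.

Lemma weighted_bloch_norm_le w f A :
  (forall z, disk z -> w (Cmod z) * Cmod (C_derive f z) <= A) ->
  exists B : R, weighted_bloch_norm w f = Finite B /\ B <= Cmod (f (RtoC 0)) + A.
Proof.
  intros HA. unfold weighted_bloch_norm.
  set (E := fun x : R => exists z : C, disk z /\ x = w (Cmod z) * Cmod (C_derive f z)).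
  destruct (Lub_Rbar_correct E) as [Hub Hle].
  specialize (Hle (Finite A)).
  assert (H0 : E (w (Cmod (RtoC 0)) * Cmod (C_derive f (RtoC 0)))).
  { exists (RtoC 0). split; [unfold disk; rewrite Cmod_0; lra|reflexivity]. }
  assert (HLe : Rbar_le (Lub_Rbar E) (Finite A)).
  { apply Hle. intros x [z [Hz ->]]. now apply HA. }
  destruct (Lub_Rbar E) as [B| |].
  - exists (Cmod (f (RtoC 0)) + B). split; [reflexivity|]. simpl in HLe. lra.
  - elim HLe.
  - elim (Hub _ H0).
Qed.

Lemma bloch_deriv_bound alpha A f :
  (forall z, disk z -> Rpower (1 - Cmod z ^ 2) alpha * Cmod (C_derive f z) <= A) ->
  deriv_bound alpha A f.
Proof.
  intros H z Hz. specialize (H z Hz).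
  pose proof (Rpower_pos (1 - Cmod z ^ 2) alpha) as Hp.
  rewrite Rpower_Ropp. apply Rmult_le_reg_l with (Rpower (1 - Cmod z ^ 2) alpha); [exact Hp|].
  replace (Rpower (1 - Cmod z ^ 2) alpha * (A * / Rpower (1 - Cmod z ^ 2) alpha))
    with A by (field; lra).
  exact H.
Qed.

(** By [sin ((alpha - 1) * PI) = sin ((2 - alpha) * PI)], which is at most [1] and at
    most [(2 - alpha) * PI]. *)
Lemma PI_sin_constant_le alpha :
  1 < alpha < 2 ->
  3 <= PI / sin ((alpha - 1) * PI) + 1 / (2 - alpha) /\
  2 / (2 - alpha) <= PI / sin ((alpha - 1) * PI) + 1 / (2 - alpha).
Proof.
  intros Hal. pose proof PI_RGT_0 as Hpi. pose proof PI2_1 as Hpi2.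
  replace (sin ((alpha - 1) * PI)) with (sin ((2 - alpha) * PI)).
  2:{ rewrite <- sin_PI_x. f_equal. ring. }
  set (x := 2 - alpha). assert (Hx : 0 < x < 1) by (unfold x; lra).
  assert (Hs : 0 < sin (x * PI)) by (apply sin_gt_0; nra).
  assert (Hs1 : sin (x * PI) <= 1) by apply SIN_bound.
  assert (Hs2 : sin (x * PI) < x * PI) by (apply sin_lt_x; nra).
  assert (H1 : PI / 1 <= PI / sin (x * PI)).
  { apply Rmult_le_compat_l; [lra|]. apply Rinv_le_contravar; lra. }
  assert (H2 : PI / (x * PI) <= PI / sin (x * PI)).
  { apply Rmult_le_compat_l; [lra|]. apply Rinv_le_contravar; lra. }
  replace (PI / (x * PI)) with (1 / x) in H2 by (field; lra).
  assert (H3 : 1 / 1 <= 1 / x).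
  { apply Rmult_le_compat_l; [lra|]. apply Rinv_le_contravar; lra. }
  split; [lra|]. replace (2 / x) with (1 / x + 1 / x) by (field; lra). lra.
Qed.

Lemma hilbert_image_norm_le alpha A a b f g :
  1 < alpha < 2 -> taylor_on_disk a f -> deriv_bound alpha A f ->
  (forall n, cseries (hilbert_term a n) (b n)) -> taylor_on_disk b g ->
  exists B : R, bloch_log_norm alpha g = Finite B /\
    B <= (PI / sin ((alpha - 1) * PI) + 1 / (2 - alpha)) * (Cmod (f (RtoC 0)) + A).
Proof.
  intros Hal Hf HA Hb Hg.
  destruct (weighted_bloch_norm_le
    (fun r => / ln (exp 1 / (1 - r) ^ 2) * Rpower (1 - r ^ 2) alpha) g
    (2 * Cmod (f (RtoC 0)) + A / (2 - alpha))
    (fun z Hz => hilbert_image_weighted_le alpha A a b f g z Hal Hf HA Hb Hg Hz))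
    as [B [HB HBle]].
  exists B. split; [exact HB|].
  pose proof (hilbert_image_at_0_le alpha A a b f g Hal Hf HA Hb Hg) as H0.
  destruct (PI_sin_constant_le alpha Hal) as [K1 K2].
  pose proof (deriv_bound_nonneg _ _ _ HA) as HA0.
  pose proof (Cmod_ge_0 (f (RtoC 0))) as Hf0.
  set (K := PI / sin ((alpha - 1) * PI) + 1 / (2 - alpha)) in *.
  apply Rle_trans with (3 * Cmod (f (RtoC 0)) + 2 / (2 - alpha) * A).
  - replace (2 / (2 - alpha) * A) with (A / (2 - alpha) + A / (2 - alpha)) by (field; lra).
    lra.
  - rewrite Rmult_plus_distr_l. apply Rplus_le_compat; now apply Rmult_le_compat_r.
Qed.

(** A vanishing norm forces [f (0) = 0] and [A = 0], and the growth estimate then makes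
    [f] vanish on the whole disk. *)
Lemma bloch_norm_pos alpha A a f :
  1 < alpha -> taylor_on_disk a f -> nonzero_on_disk f -> deriv_bound alpha A f ->
  0 < Cmod (f (RtoC 0)) + A.
Proof.
  intros Hal Hf [z [Hz Hfz]] HA.
  pose proof (deriv_bound_nonneg _ _ _ HA) as HA0.
  destruct (Cmod_ge_0 (f (RtoC 0))) as [H|H]; [lra|].
  destruct HA0 as [H'|H']; [lra|]. exfalso. apply Hfz.
  pose proof (deriv_bound_growth a f alpha A Hf Hal HA z Hz) as Hgr.
  rewrite <- H' in Hgr. unfold Rdiv in Hgr. rewrite !Rmult_0_l in Hgr.
  rewrite (Cmod_eq_0 _ (eq_sym H)) in Hgr.
  apply Cmod_eq_0. pose proof (Cmod_ge_0 (f z)).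
  replace (f z - 0)%C with (f z) in Hgr by ring. lra.
Qed.

Theorem theorem6p2 : forall alpha : R, 1 < alpha < 2 ->
  hilbert_acts alpha /\
  Rbar_le (hilbert_norm alpha)
    (Finite (PI / sin ((alpha - 1) * PI) + 1 / (2 - alpha))).
Proof.
  intros alpha Hal. split.
  - intros f [[a Hf] Hfin].
    destruct (weighted_bloch_norm_finite _ f Hfin) as [A [_ HA]].
    apply bloch_deriv_bound in HA.
    destruct (hilbert_coefs_exist a f alpha A Hal Hf HA) as [b Hb].
    destruct (hilbert_image_exists alpha A a b f Hal Hf HA Hb) as [g Hg].
    destruct (hilbert_image_norm_le alpha A a b f g Hal Hf HA Hb Hg) as [B [HB _]].
    exists g. split; [exists a, b; split; [exact Hf|split; [exact Hb|exact Hg]]|].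
    split; [now exists b|]. now rewrite HB.
  - apply (proj2 (proj2_sig (Rbar_ex_lub _))). intros x (f & g & [_ Hfin] & Hnz & (a & b & Hf & Hb & Hg) & ->).
    destruct (weighted_bloch_norm_finite _ f Hfin) as [A [Hnorm HA]].
    apply bloch_deriv_bound in HA.
    destruct (hilbert_image_norm_le alpha A a b f g Hal Hf HA Hb Hg) as [B [HB HBle]].
    pose proof (bloch_norm_pos alpha A a f (proj1 Hal) Hf Hnz HA) as Hpos.
    unfold bloch_norm. rewrite HB, Hnorm. simpl.
    apply Rmult_le_reg_r with (Cmod (f (RtoC 0)) + A); [exact Hpos|].
    rewrite Rmult_assoc, Rinv_l by lra. lra.
Qed.
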